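(* Each of the following groups $G$ has Cayley index $c(G)=2$, and the Cayley graph $\mathrm{Cay}(G,S)$ with the listed connection set $S$ satisfies $c(\mathrm{Cay}(G,S))=2$: \begin{itemize} \item $G=D_{2n}=\langle a,b: a^2=b^n=1,\ aba=b^{-1}\rangle$ for $n\in\{3,4,5\}$, with $S=\{a,ab\}$; \item $G=A_4$, the alternating group of degree $4$, with $S=\{(1\,2\,3)^{\pm1},(1\,2)(3\,4)\}$; \item $G=H_1=\langle a,b,c: a^2=b^2=c^2=1,\ abc=bca=cab\rangle$ (of order $16$), with $S=\{a,b,c,(ab)^{\pm1}\}$; \item $G=H_2=\langle a,b: a^8=b^2=1,\ bab=a^5\rangle$ (of order $16$), with $S=\{a^{\pm1},a^{\pm2},b\}$; \item $G=H_3=\langle a,b,c: a^3=b^3=c^2=1,\ ab=ba,\ (ac)^2=(bc)^2=1\rangle$ (of order $18$), with $S=\{a^{\pm1},c,ac,bc\}$; \item $G=H_4=\langle a,b,c: a^3=b^3=c^3=1,\ ac=ca,\ bc=cb,\ b^{-1}ab=ac\rangle$ (of order $27$), with $S=\{a^{\pm1},b^{\pm1},(a^{-1}b)^{\pm1},(bab^{-1})^{\pm1}\}$; \item $G=Q_8\times\mathbb{Z}_3=\langle i,j,z: z^3=1,\ iz=zi,\ jz=zj\rangle$, with $S=\{\pm i,(iz)^{\pm1},(jz)^{\pm1}\}$; \item $G=Q_8\times\mathbb{Z}_4=\langle i,j,z: z^4=1,\ iz=zi,\ jz=zj\rangle$, with $S=\{z^{\pm1},\pm i,\pm j,(iz)^{\pm1},(-kz)^{\pm1}\}$.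 \end{itemize}
   Context: All groups and graphs are finite; graphs are simple, undirected and without loops. For a group $G$ and a subset $S\subseteq G$ with $S=S^{-1}$ and $1\notin S$, the Cayley graph $\mathrm{Cay}(G,S)$ with connection set $S$ has vertex set $G$ and edges $\{g,gs\}$ for $g\in G$, $s\in S$. The left-regular representation $L_G$ of $G$ is a subgroup of $\mathrm{Aut}(\mathrm{Cay}(G,S))$. The Cayley index of $\Gamma=\mathrm{Cay}(G,S)$ is $c(\Gamma)=|\mathrm{Aut}(\Gamma):L_G|$, and the Cayley index of the group $G$ is $c(G)=\min_S c(\mathrm{Cay}(G,S))$, the minimum over all subsets $S\subseteq G$ with $S=S^{-1}$ and $1\notin S$. $Q_8=\{\pm1,\pm i,\pm j,\pm k\}$ is the usual quaternion group of order $8$; in the last two items $i,j$ generate $Q_8$ (with the usual relations, $k=ij$) and $z$ generates the cyclic direct factor. *)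

(* Defs.v *)
From mathcomp Require Import all_boot all_fingroup all_solvable.

Set Implicit Arguments.
Unset Strict Implicit.
Unset Printing Implicit Defensive.

Local Open Scope group_scope.

Section Graphs.

Variable T : finType.
Implicit Types (V : {set T}) (e : rel T) (s : {perm T}).

(* Automorphisms of the graph with vertex set V and adjacency relation e;     *)
(* like the elements of Aut G and Sym G, they are extended by the identity    *)
(* outside V.                                                                 *)
Definition graph_aut V e : {set {perm T}} :=
  [set s | perm_on V s
         & [forall x in V, forall y in V, e (s x) (s y) == e x y]].

Lemma graph_aut_group_set V e : group_set (graph_aut V e).
Proof.
apply/group_setP; split=> [|s t].
  rewrite inE perm_on1; apply/forall_inP=> x _; apply/forall_inP=> y _.
  by rewrite !perm1.
rewrite !inE => /andP[Vs /forall_inP es] /andP[Vt /forall_inP et].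
rewrite perm_onM //; apply/forall_inP=> x Vx; apply/forall_inP=> y Vy.
have Vsx: s x \in V by rewrite perm_closed.
have Vsy: s y \in V by rewrite perm_closed.
have /forall_inP/(_ _ Vsy)/eqP ets := et _ Vsx.
have /forall_inP/(_ _ Vy)/eqP esx := es _ Vx.
by rewrite !permM ets esx.
Qed.

Canonical graph_aut_group V e := Group (graph_aut_group_set V e).

End Graphs.

Section Cayley.

Variable gT : finGroupType.
Implicit Types (G : {group gT}) (S : {set gT}).

Definition connection_set G S : bool :=
  [&& S \subset G, S^-1 == S & 1 \notin S].

Definition cayley_rel G S : rel gT :=
  [rel x y | (x \in G) && [exists s in S, y == x * s]].

(* x |-> g * x on G, extended by the identity outside G.                      *)
Definition left_regular G : {set {perm gT}} :=
  [set s : {perm gT} | perm_on G s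
         & [exists g in G, forall x in G, s x == g * x]].

Definition cayley_index G S : nat :=
  #|graph_aut G (cayley_rel G S) : left_regular G|.

(* The minimum of cayley_index G S over all connection sets S; set0 is one.   *)
Definition group_cayley_index G : nat :=
  cayley_index G
    [arg min_(S < set0 | connection_set G S) cayley_index G S]%N.

Lemma connection_set0 G : connection_set G set0.
Proof.
rewrite /connection_set sub0set in_set0 andbT.
by apply/eqP/setP=> x; rewrite !inE.
Qed.

Lemma group_cayley_index_min G S :
  connection_set G S -> group_cayley_index G <= cayley_index G S.
Proof.
rewrite /group_cayley_index; case: arg_minnP => [|S0 _ minS0].
  exact: connection_set0.
exact: minS0.
Qed.

Lemma group_cayley_index_ex G :
  exists2 S, connection_set G S & group_cayley_index G = cayley_index G S.
Proof.
rewrite /group_cayley_index; case: arg_minnP => [|S0 cS0 _].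
  exact: connection_set0.
by exists S0.
Qed.

Lemma cayley_sym G S :
  connection_set G S -> symmetric (cayley_rel G S).
Proof.
case/and3P=> /subsetP sSG /eqP SV _.
suffices sub x y: cayley_rel G S x y -> cayley_rel G S y x.
  by move=> x y; apply/idP/idP; apply: sub.
case/andP=> Gx /exists_inP[s Ss /eqP->]; apply/andP; split.
  by rewrite groupM // sSG.
by apply/exists_inP; exists s^-1; rewrite ?mulgK // -mem_invg SV.
Qed.

Lemma cayley_irrefl G S :
  connection_set G S -> irreflexive (cayley_rel G S).
Proof.
case/and3P=> _ _ S1 x; apply/andP=> -[_ /exists_inP[s Ss]].
by rewrite -{1}[x]mulg1 (inj_eq (mulgI x)) => /eqP s1; rewrite s1 Ss in S1.
Qed.

Lemma left_regular_group_set G : group_set (left_regular G).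
Proof.
apply/group_setP; split=> [|s t].
  rewrite inE perm_on1; apply/exists_inP; exists 1 => //.
  by apply/forall_inP=> x _; rewrite perm1 mul1g.
rewrite !inE => /andP[Gs /exists_inP[g Gg /forall_inP sg]].
case/andP=> Gt /exists_inP[h Gh /forall_inP th].
rewrite perm_onM //; apply/exists_inP; exists (h * g); first exact: groupM.
apply/forall_inP=> x Gx.
by rewrite permM (eqP (sg x Gx)) (eqP (th _ (groupM Gg Gx))) mulgA.
Qed.

Canonical left_regular_group G := Group (left_regular_group_set G).

Lemma left_regular_sub G S :
  left_regular G \subset graph_aut G (cayley_rel G S).
Proof.
apply/subsetP=> s; rewrite !inE.
case/andP=> -> /exists_inP[g Gg /forall_inP sg].
apply/forall_inP=> x Gx; apply/forall_inP=> y Gy.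
rewrite /cayley_rel /= (eqP (sg x Gx)) (eqP (sg y Gy)) Gx groupM //=.
apply/eqP/eq_existsb=> h; congr (_ && _).
by rewrite -mulgA (inj_eq (mulgI g)).
Qed.

Lemma card_left_regular G : #|left_regular G| = #|G|.
Proof.
have injf g: injective (fun x => if (g \in G) && (x \in G) then g * x else x).
  move=> x y /=; case Gg: (g \in G) => //=.
  case: ifPn => Gx; case: ifPn => Gy //; first exact: mulgI.
    by move=> def_y; rewrite -def_y groupMl ?Gx in Gy.
  by move=> def_x; rewrite def_x groupMl ?Gy in Gx.
have <-: [set perm (injf g) | g in G] = left_regular G.
  apply/setP=> s; apply/imsetP/idP => [[g Gg ->]|].
    rewrite inE; apply/andP; split.
      by apply/subsetP=> x; rewrite inE permE Gg /=; case: ifP; rewrite ?eqxx.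
    apply/exists_inP; exists g => //; apply/forall_inP=> x Gx.
    by rewrite permE Gg Gx.
  rewrite inE => /andP[Gs /exists_inP[g Gg /forall_inP sg]].
  exists g => //; apply/permP=> x; rewrite permE Gg /=.
  by case: ifPn => Gx; [rewrite (eqP (sg x Gx)) | rewrite (out_perm Gs)].
rewrite card_in_imset // => g h Gg Gh /permP/(_ 1).
by rewrite !permE Gg Gh group1 /= !mulg1.
Qed.

End Cayley.

(* In the predicates below, G is defined by a presentation and the named      *)
(* elements are the corresponding generators: G \isog Grp (...) determines G  *)
(* up to isomorphism, but does not say which elements of G are the            *)
(* generators, so they are also required to generate G and to satisfy the     *)
(* relations. Since G is finite, mapping the formal generators to these       *)
(* elements is then an isomorphism.                                           *)
Section Presentations.

Variables (gT : finGroupType) (G : {group gT}).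
Implicit Types a b c i j z : gT.

Definition dihedral_gens n a b : Prop :=
  [/\ G \isog Grp (a : b : a ^+ 2, b ^+ n, a * b * a = b^-1),
      <<[set a; b]>> = G
    & [/\ a ^+ 2 = 1, b ^+ n = 1 & a * b * a = b^-1]].

Definition H1_gens a b c : Prop :=
  [/\ G \isog Grp (a : b : c : a ^+ 2, b ^+ 2, c ^+ 2,
                      a * b * c = b * c * a = c * a * b),
      <<[set a; b; c]>> = G
    & [/\ a ^+ 2 = 1, b ^+ 2 = 1, c ^+ 2 = 1,
          a * b * c = b * c * a & b * c * a = c * a * b]].

Definition H2_gens a b : Prop :=
  [/\ G \isog Grp (a : b : a ^+ 8, b ^+ 2, b * a * b = a ^+ 5),
      <<[set a; b]>> = G
    & [/\ a ^+ 8 = 1, b ^+ 2 = 1 & b * a * b = a ^+ 5]].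

Definition H3_gens a b c : Prop :=
  [/\ G \isog Grp (a : b : c : a ^+ 3, b ^+ 3, c ^+ 2, a * b = b * a,
                      (a * c) ^+ 2, (b * c) ^+ 2),
      <<[set a; b; c]>> = G,
      [/\ a ^+ 3 = 1, b ^+ 3 = 1 & c ^+ 2 = 1]
    & [/\ a * b = b * a, (a * c) ^+ 2 = 1 & (b * c) ^+ 2 = 1]].

Definition H4_gens a b c : Prop :=
  [/\ G \isog Grp (a : b : c : a ^+ 3, b ^+ 3, c ^+ 3, a * c = c * a,
                      b * c = c * b, b^-1 * a * b = a * c),
      <<[set a; b; c]>> = G,
      [/\ a ^+ 3 = 1, b ^+ 3 = 1 & c ^+ 3 = 1]
    & [/\ a * c = c * a, b * c = c * b & b^-1 * a * b = a * c]].

(* G is the internal direct product of a quaternion group generated by i, j   *)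
(* and of a cyclic group of order n generated by z. Any two generators of     *)
(* 'Q_8 satisfy the usual relations, with -1 = i ^+ 2 and k = i * j.          *)
Definition Q8xZ_gens n i j z : Prop :=
  [/\ <<[set i; j]>> \x <[z]> = G, <<[set i; j]>> \isog 'Q_8 & #[z] = n].

End Presentations.

(* The points 1, 2, 3, 4 on which A_4 acts.                                   *)
Definition pt1 : 'I_4 := @Ordinal 4 0 isT.
Definition pt2 : 'I_4 := @Ordinal 4 1 isT.
Definition pt3 : 'I_4 := @Ordinal 4 2 isT.
Definition pt4 : 'I_4 := @Ordinal 4 3 isT.

(* Products of permutations act from left to right, so this is (1 2 3).       *)
Definition cycle123 : {perm 'I_4} := tperm pt1 pt2 * tperm pt1 pt3.

Definition swap12_34 : {perm 'I_4} := tperm pt1 pt2 * tperm pt3 pt4.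

Definition index_two_witness (gT : finGroupType) (G : {group gT})
    (S : {set gT}) : Prop :=
  [/\ connection_set G S, cayley_index G S = 2 & group_cayley_index G = 2].

(* Main.v *)
Require Import Defs.
From mathcomp Require Import all_boot all_fingroup all_solvable.
From mathcomp Require Import zmodp.

Set Implicit Arguments.
Unset Strict Implicit.
Unset Printing Implicit Defensive.

Local Open Scope group_scope.

(** The value 2 is a lower bound because each of these groups has the following
property: every inverse-closed subset without the identity is invariant under a
nontrivial group automorphism. Such an automorphism is an automorphism of the
Cayley graph that fixes the vertex 1, and the Cayley index is the order of the
stabiliser of 1 in the automorphism group of the graph
([cayley_index_stabiliser]). A short list of automorphisms suffices for each
group: an automorphism preserves a subset when membership agrees on certain
pairs of elements, and a branching on the membership of single elements shows
that every subset satisfies the constraints of some automorphism in the list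
([covers], [certified_lower_bound]).

The value 2 is attained because a search through the injective partial maps
that preserve adjacency and its negation finds only two automorphisms of the
given Cayley graph that fix 1 ([rigid_stabiliser]).

Both arguments are finite computations with the multiplication by the
generators, tabulated on codes 0, ..., n - 1. They apply to an arbitrary group
with the given presentation by coset enumeration over the trivial subgroup:
[edges_hold] shows that the relations imply all entries of the table, so the
group has at most n elements, and the columns of the table generate a group of
permutations that satisfies the relations and has at least n elements
([model_large]). This model also shows that a group with the presentation exists
([presentation_ex]), and comparing the values of words in two groups that
satisfy the relations gives the morphisms that define the automorphisms
([von_dyck]).

For the alternating group and the direct products with the quaternion group the
order is known in advance, and it only remains to see that the named elements
generate and satisfy the relations ([A4_generated], [quaternion_generators]). *)

(** * Words in generators *)

(** A letter is a generator number together with a flag that is true for the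
inverse of that generator. *)
Definition letter := (bool * nat)%type.
Definition word := seq letter.

Definition inverse_word (u : word) : word :=
  rev [seq (~~ l.1, l.2) | l <- u].

Section WordValues.

Variable gT : finGroupType.
Implicit Types (gs : seq gT) (u v : word).

Definition letter_value gs (l : letter) : gT :=
  if l.1 then (nth 1 gs l.2)^-1 else nth 1 gs l.2.

Definition word_value gs u : gT :=
  foldr (fun l x => letter_value gs l * x) 1 u.

Lemma word_value_cat gs u v :
  word_value gs (u ++ v) = word_value gs u * word_value gs v.
Proof. by elim: u => [|l u IHu] /=; rewrite ?mul1g // IHu mulgA. Qed.

Lemma word_value_rcons gs u l :
  word_value gs (rcons u l) = word_value gs u * letter_value gs l.
Proof. by rewrite -cats1 word_value_cat /= mulg1. Qed.

Lemma word_value_inverse gs u :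
  word_value gs (inverse_word u) = (word_value gs u)^-1.
Proof.
rewrite /inverse_word; elim: u => [|l u IHu] /=; first by rewrite invg1.
rewrite rev_cons word_value_rcons IHu invMg; congr (_ * _).
by case: l => [[] i] //=; rewrite /letter_value /= invgK.
Qed.

Lemma word_value_gen gs u : word_value gs u \in <<[set x in gs]>>.
Proof.
elim: u => [|[b i] u IHu] /=; first exact: group1.
rewrite groupM // /letter_value /=.
suffices Gi: nth 1 gs i \in <<[set x in gs]>> by case: b; rewrite ?groupV.
have [ltis | leis] := ltnP i (size gs); last by rewrite nth_default.
by rewrite mem_gen // inE mem_nth.
Qed.

End WordValues.

(** * Presentations as lists of relators *)

Section Relators.

Import Presentation.

Fixpoint word_of_term (t : term) : word :=
  match t with
  | Cst i => [:: (false, i)]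
  | Idx => [::]
  | Inv t1 => inverse_word (word_of_term t1)
  | Exp t1 n => iter n (cat (word_of_term t1)) [::]
  | Mul t1 t2 => word_of_term t1 ++ word_of_term t2
  | Conj t1 t2 =>
    inverse_word (word_of_term t2) ++ word_of_term t1 ++ word_of_term t2
  | Comm t1 t2 =>
    inverse_word (word_of_term t1) ++ inverse_word (word_of_term t2)
      ++ word_of_term t1 ++ word_of_term t2
  end.

Lemma word_of_termE (gT : finGroupType) (gs : seq gT) t :
  word_value gs (word_of_term t) = eval gs t.
Proof.
elim: t => //= [i|t <-|t <- n|t <- u <-|t <- u <-|t <- u <-];
  rewrite ?word_value_cat ?word_value_inverse ?mulg1 //.
by elim: n => //= n IHn; rewrite word_value_cat IHn expgS.
Qed.

Fixpoint equations (f : formula) : seq (term * term) :=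
  match f with
  | Eq2 s t => [:: (s, t)]
  | And f1 f2 => equations f1 ++ equations f2
  end.

Fixpoint arity_from n p : nat :=
  match p with
  | Generator p' => arity_from n.+1 (p' (Cst n))
  | Formula _ => n
  end.

Fixpoint equations_from n p : seq (term * term) :=
  match p with
  | Generator p' => equations_from n.+1 (p' (Cst n))
  | Formula f => equations f
  end.

(** A presentation is a term in higher-order abstract syntax; applying it to
the constants numbered 0, 1, and so on makes every relation s = t readable as
the relator s * t^-1, a word that tables can scan. *)
Definition relators (p : term -> type) : seq word :=
  [seq word_of_term st.1 ++ inverse_word (word_of_term st.2)
     | st <- equations_from 1 (p (Cst 0))].

Definition arity (p : term -> type) := arity_from 1 (p (Cst 0)).

Definition satisfies (gT : finGroupType) (gs : seq gT) (rels : seq word) :=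
  all (fun r => word_value gs r == 1) rels.

Lemma satisfies_relators (gT : finGroupType) (gs : seq gT) p :
  satisfies gs (relators p) =
  all (fun st => eval gs st.1 == eval gs st.2) (equations_from 1 (p (Cst 0))).
Proof.
rewrite /satisfies all_map; apply: eq_all => st /=.
by rewrite word_value_cat word_value_inverse !word_of_termE -eq_mulgV1.
Qed.

(** The definition of being an image of a presented group quantifies over
nested tuples of generators; here they become a sequence, so that presentations
with any number of generators can be treated at once. *)
Lemma homGrpE (gT : finGroupType) (B : {set gT}) p :
  reflect (exists gs, [/\ size gs = arity p, <<[set x in gs]>> = B
                        & satisfies gs (relators p)])
          (B \homg Grp p).
Proof.
have and_relE xT x1 x2 r: @and_rel xT x1 x2 r = (x1 == x2) && r :> bool.
  by case: r => //=; rewrite andbT.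
have relE e f r: rel e f r
    = all (fun st => eval e st.1 == eval e st.2) (equations f) && r :> bool.
  move: (gT : finGroupType) e r => rT e.
  elim: f => [s t | f1 IH1 f2 IH2] r /=; first by rewrite and_relE andbT.
  by rewrite IH1 IH2 all_cat andbA.
have genJ (x : gT) e: <<[set y in e]>> <*> <[x]> = <<[set y in x :: e]>>.
  rewrite joing_idl joing_idr; congr <<_>>.
  by apply/setP=> y; rewrite !inE orbC.
have set_rev (e : seq gT): [set x in rev e] = [set x in e].
  by apply/setP=> x; rewrite !inE mem_rev.
(* [satE] strengthens the goal to the state reached after reading n of the
   generators: [sat] accumulates them in reverse, in a tuple of type vT whose
   value is recovered by s. *)
have satE: forall q n (vT : finType) (s : vT -> env gT),
    (forall v, exists2 e, size e = n & s v = Env <<[set x in e]>> e) ->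
    (forall e, size e = n -> exists v, s v = Env <<[set x in e]>> e) ->
  reflect (exists gs, [/\ size gs = arity_from n q, <<[set x in gs]>> = B
                        & all (fun st => eval gs st.1 == eval gs st.2)
                              (equations_from n q)])
          (sat B n s q).
- elim=> [q IHq | f] n vT s sv sv_ex /=.
    apply: (IHq (Cst n) n.+1) => [[v x] | e size_e] /=.
      case: (sv v) => e <- ->; exists (x :: e) => //; congr Env.
      by rewrite genJ.
    case: e size_e => // x e [/sv_ex[v def_v]]; exists (v, x).
    by rewrite /= def_v genJ.
  apply: (iffP existsP) => [[v] | [gs [size_gs defB rels]]].
    case: (sv v) => e size_e ->; rewrite and_relE relE andbT.
    case/andP=> /eqP defB rels; exists (rev e).
    by rewrite size_rev -defB set_rev.
  have [|v def_v] := sv_ex (rev gs); first by rewrite size_rev.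
  by exists v; rewrite def_v and_relE relE revK rels -defB set_rev eqxx.
apply: (iffP (satE (p (Cst 0)) 1%N gT _ _ _)) => [v|[|x []] //||] /=.
- by exists [:: v] => //; congr Env; congr <<_>>; apply/setP=> x; rewrite !inE.
- by exists x; congr Env; congr <<_>>; apply/setP=> y; rewrite !inE.
- by case=> gs [? ? ?]; exists gs; rewrite satisfies_relators.
by case=> gs [? ?]; rewrite satisfies_relators; exists gs.
Qed.

End Relators.

(** * Coset enumeration over the trivial subgroup *)

Section Table.

(** The n elements of the group are coded by 0, ..., n - 1, with 0 for the
identity. Column i lists the codes of the products of the elements by the
generator i, and ws lists one word for each element. *)
Variables (n : nat) (cols : seq (seq nat)) (ws : seq word).
Implicit Types (k : nat) (l : letter) (u : word) (e : nat * nat).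

Definition column i := nth [::] cols i.

Definition target e := nth 0 (column e.2) e.1.

Definition step k l :=
  if l.1 then index k (column l.2) else target (k, l.2).

Definition scan k u := foldl step k u.

Definition well_formed u := all (fun l => l.2 < size cols) u.

(** The edge (k, i) stands for the claim that the word of k times the
generator i has the same value as the word of the code in row k of column i. *)
Definition edges := [seq (k, i) | k <- iota 0 n, i <- iota 0 (size cols)].

Definition normal_form k := nth [::] ws k.

Definition edge_of k l := if l.1 then (step k l, l.2) else (k, l.2).

Fixpoint trace k u :=
  if u is l :: u' then edge_of k l :: trace (step k l) u' else [::].

(** When a relator is scanned from k, the path returns to k; if a single edge
of that path is not known to hold, cancellation shows that it holds. *)
Definition deduce known (kr : nat * word) :=
  if [seq e <- trace kr.1 kr.2 | e \notin known] is [:: e]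
  then e :: known else known.

(** These edges hold by the choice of the words. *)
Definition definition_edges :=
  [seq e <- edges |
     normal_form (target e) == rcons (normal_form e.1) (false, e.2)].

(** Two passes over all relators and codes close each of the tables below. *)
Definition known_edges (rels : seq word) :=
  let scans := [seq (k, r) | r <- rels, k <- iota 0 n] in
  foldl deduce definition_edges (scans ++ scans).

(** The table is a permutation representation in which the relators act
trivially, so the group is not smaller than the table; and the relators imply
every entry of the table, so the group is not larger. *)
Definition complete_table (rels : seq word) :=
  [&& 0 < n, all (fun c => perm_eq c (iota 0 n)) cols, all well_formed rels,
      all (fun r => all (fun k => scan k r == k) (iota 0 n)) rels,
      normal_form 0 == [::], all well_formed ws,
      all (fun k => scan 0 (normal_form k) == k) (iota 0 n)
    & let known := known_edges rels in all (fun e => e \in known) edges].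

Section Complete.

Variable rels : seq word.
Hypothesis tab : complete_table rels.

Lemma table_gt0 : 0 < n. Proof. by case/and5P: tab. Qed.

Lemma column_perm i : i < size cols -> perm_eq (column i) (iota 0 n).
Proof. by case/and5P: tab => _ /allP cP _ _ _ lti; rewrite cP ?mem_nth. Qed.

Lemma size_column i : i < size cols -> size (column i) = n.
Proof. by move/column_perm/perm_size->; rewrite size_iota. Qed.

Lemma mem_column i k : i < size cols -> (k \in column i) = (k < n).
Proof. by move/column_perm/perm_mem->; rewrite mem_iota. Qed.

Lemma step_lt k l : l.2 < size cols -> k < n -> step k l < n.
Proof.
case: l => [[] i] /= lti ltk; rewrite /step /=.
  by rewrite -[X in _ < X](size_column lti) index_mem mem_column.
by rewrite -(mem_column _ lti) mem_nth ?size_column.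
Qed.

Lemma scan_lt k u : well_formed u -> k < n -> scan k u < n.
Proof.
by elim: u k => //= l u IHu k /andP[wl wu] ltk; apply/IHu/step_lt.
Qed.

Lemma normal_form0 : normal_form 0 = [::].
Proof. by case/and5P: tab => _ _ _ _ /andP[/eqP]. Qed.

Lemma normal_form_wf k : well_formed (normal_form k).
Proof.
case/and5P: tab => _ _ _ _ /and4P[_ /allP wfs _ _].
have [lt_k | le_k] := ltnP k (size ws); first by rewrite wfs ?mem_nth.
by rewrite /normal_form nth_default.
Qed.

Lemma scan_normal_form k : k < n -> scan 0 (normal_form k) = k.
Proof.
case/and5P: tab => _ _ _ _ /and4P[_ _ /allP nfK _] ltk.
by apply/eqP/nfK; rewrite mem_iota.
Qed.

Lemma inverse_wf u : well_formed u -> well_formed (inverse_word u).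
Proof. by rewrite /well_formed all_rev all_map. Qed.

Section Values.

Variables (gT : finGroupType) (gs : seq gT).

Definition elt k : gT := word_value gs (normal_form k).

Definition edge_holds e := elt e.1 * nth 1 gs e.2 = elt (target e).

Lemma edge_holds_step k l :
    l.2 < size cols -> k < n ->
  edge_holds (edge_of k l) <-> elt k * letter_value gs l = elt (step k l).
Proof.
case: l => [[] i] //= lti ltk; rewrite /edge_holds /letter_value /=.
rewrite /target /step /= nth_index ?mem_column //.
by split=> <-; rewrite ?mulgK ?mulgKV.
Qed.

Lemma trace_holds k u :
    well_formed u -> k < n -> {in trace k u, forall e, edge_holds e} ->
  elt k * word_value gs u = elt (scan k u).
Proof.
elim: u k => [|l u IHu] k /=; first by rewrite mulg1.
case/andP=> wl wu ltk holds; rewrite mulgA.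
have/(edge_holds_step wl ltk)->: edge_holds (edge_of k l).
  by apply: holds; rewrite mem_head.
apply: IHu => [||e u_e] //; rewrite ?step_lt //.
by apply: holds; rewrite inE u_e orbT.
Qed.

(** Everything before the unknown edge can be absorbed into the starting
point; everything after it cancels on the right. *)
Lemma deduce_holds k u (known : seq (nat * nat)) e :
    well_formed u -> k < n -> elt k * word_value gs u = elt (scan k u) ->
    {in known, forall e', edge_holds e'} ->
  [seq e' <- trace k u | e' \notin known] = [:: e] -> edge_holds e.
Proof.
move=> + + + holds; elim: u k => //= l u IHu k /andP[wl wu] ltk eq_u.
have ltk' := step_lt wl ltk.
case: ifPn => [_ [<- /eqP] | /negbNE/holds/(edge_holds_step wl ltk) eq_l].
  rewrite -size_eq0 size_filter -leqn0 leqNgt -has_count => u_known.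
  apply/(edge_holds_step wl ltk)/(mulIg (word_value gs u)).
  rewrite -mulgA eq_u -(trace_holds wu ltk') // => e' u_e'; apply: holds.
  by apply: contraR u_known => ?; apply/hasP; exists e'.
by apply: IHu => //; rewrite -eq_l -mulgA.
Qed.

Hypothesis sat : satisfies gs rels.

Lemma edges_hold k i : k < n -> i < size cols -> edge_holds (k, i).
Proof.
case/and5P: tab => n_gt0 _ /allP wfr /allP clr.
case/and4P=> _ _ _ /allP known ltk lti.
pose scans := [seq (k, r) | r <- rels, k <- iota 0 n].
have scansP: {in scans ++ scans, forall kr, [/\ kr.1 < n, well_formed kr.2,
    scan kr.1 kr.2 = kr.1 & word_value gs kr.2 = 1]}.
  move=> _ /[!mem_cat] /orP[]/allpairsP[[r j] /= [r_in + ->]];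
    rewrite mem_iota => j_lt /=; split=> //; try exact: wfr;
    by [apply/eqP/(allP (clr r r_in)); rewrite mem_iota | apply/eqP/(allP sat)].
suffices foldP s known0: {subset s <= scans ++ scans} ->
    {in known0, forall e, edge_holds e} ->
  {in foldl deduce known0 s, forall e, edge_holds e}.
- apply: (foldP (scans ++ scans) definition_edges) => // [e|].
    rewrite mem_filter => /andP[/eqP def_e _].
    by rewrite /edge_holds /elt def_e word_value_rcons.
  by apply: known; apply/allpairsP; exists (k, i); rewrite /= !mem_iota.
elim: s known0 => //= -[j r] s IHs known0 s_in holds.
apply: IHs => [kr s_kr | e]; first by apply: s_in; rewrite inE s_kr orbT.
have [/= ltj wr cl_r r1] := scansP _ (s_in _ (mem_head _ _)).
rewrite /deduce; case def_e: [seq _ <- _ | _] => [|e1 [|? ?]]; try exact: holds.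
rewrite inE => /predU1P[-> | /holds//].
by apply: deduce_holds def_e => //=; rewrite r1 mulg1 cl_r.
Qed.

Lemma elt_scan k u :
  well_formed u -> k < n -> elt k * word_value gs u = elt (scan k u).
Proof.
elim: u k => [|l u IHu] k /=; first by rewrite mulg1.
case/andP=> wl wu ltk; rewrite mulgA.
have/(edge_holds_step wl ltk)->: edge_holds (edge_of k l).
  by case: l wl => [[] i] wl; apply: edges_hold; rewrite ?step_lt.
by rewrite IHu ?step_lt.
Qed.

Lemma elt0 : elt 0 = 1. Proof. by rewrite /elt normal_form0. Qed.

Lemma elt_word u : well_formed u -> word_value gs u = elt (scan 0 u).
Proof. by move=> wu; rewrite -elt_scan ?table_gt0 // elt0 mul1g. Qed.

Lemma elt_mul j k : j < n -> elt j * elt k = elt (scan j (normal_form k)).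
Proof. by move=> ltj; rewrite elt_scan ?normal_form_wf. Qed.

Lemma elt_gen k : elt k \in <<[set x in gs]>>.
Proof. exact: word_value_gen. Qed.

Hypothesis size_gs : size gs = size cols.

Let elts := [set elt k | k : 'I_n].

Let mem_elts k : k < n -> elt k \in elts.
Proof. by move=> ltk; apply/imsetP; exists (Ordinal ltk). Qed.

(** The values of the words contain 1 and the generators, and the table
shows that they are closed under products. *)
Lemma elt_surj x : x \in <<[set y in gs]>> -> exists2 k, k < n & x = elt k.
Proof.
have gA: group_set elts.
  apply/group_setP; split=> [|_ _ /imsetP[j _ ->] /imsetP[k _ ->]].
    by rewrite -elt0 mem_elts ?table_gt0.
  by rewrite elt_mul // mem_elts // scan_lt ?normal_form_wf.
have sGA: <<[set y in gs]>> \subset Group gA.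
  rewrite gen_subG; apply/subsetP=> y; rewrite inE => /(nthP 1)[i lti <-].
  rewrite size_gs in lti.
  have wi: well_formed [:: (false, i)] by rewrite /= lti.
  have ->: nth 1 gs i = word_value gs [:: (false, i)] by rewrite /= mulg1.
  by rewrite elt_word // mem_elts ?scan_lt ?table_gt0.
by move/(subsetP sGA)/imsetP=> [k _ ->]; exists k.
Qed.

Lemma card_gen_le : #|<<[set y in gs]>>| <= n.
Proof.
have/subset_leq_card: <<[set y in gs]>> \subset elts.
  by apply/subsetP=> _ /elt_surj[k ltk ->]; apply: mem_elts.
by move/leq_trans; apply; rewrite -[X in _ <= X]card_ord leq_imset_card.
Qed.

(** For a group that is as large as the table the words have distinct values,
so that codes and elements correspond. *)
Hypothesis large : n <= #|<<[set y in gs]>>|.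

Lemma card_gen : #|<<[set y in gs]>>| = n.
Proof. by apply/eqP; rewrite eqn_leq card_gen_le. Qed.

Lemma elt_inj j k : j < n -> k < n -> elt j = elt k -> j = k.
Proof.
have: #|elts| == #|'I_n|.
  rewrite eqn_leq leq_imset_card card_ord (leq_trans large) //.
  apply/subset_leq_card.
  by apply/subsetP=> _ /elt_surj[i lti ->]; apply: mem_elts.
move/imset_injP=> inj ltj ltk eq_jk.
by have /(congr1 val) := inj (Ordinal ltj) (Ordinal ltk) isT isT eq_jk.
Qed.

Definition code x := index x [seq elt k | k <- iota 0 n].

Lemma codeK : {in <<[set y in gs]>>, cancel code elt}.
Proof.
move=> _ /elt_surj[k ltk ->]; rewrite /code.
have k_in: elt k \in [seq elt k | k <- iota 0 n] by rewrite map_f ?mem_iota.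
have:= k_in; rewrite -index_mem size_map size_iota => lt_i.
by rewrite -[RHS](nth_index 1 k_in) (nth_map 0) ?size_iota // nth_iota.
Qed.

Lemma code_lt x : x \in <<[set y in gs]>> -> code x < n.
Proof.
case/elt_surj=> k ltk ->; rewrite -[X in _ < X](size_iota 0) -(size_map elt).
by rewrite index_mem map_f ?mem_iota.
Qed.

Lemma eltK k : k < n -> code (elt k) = k.
Proof.
by move=> ltk; apply: elt_inj; rewrite ?codeK ?code_lt ?elt_gen.
Qed.

End Values.

(** Products of words are read off the same table in both groups, so sending
the value of each word to its value in the other group is a morphism. *)
Lemma von_dyck (gT rT : finGroupType) (gs : seq gT) (hs : seq rT) :
    satisfies gs rels -> size gs = size cols ->
    n <= #|<<[set x in gs]>>| -> satisfies hs rels ->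
  exists f : {morphism <<[set x in gs]>> >-> rT},
    forall k, k < n -> f (elt gs k) = elt hs k.
Proof.
move=> sat_gs size_gs large sat_hs.
pose f x := elt hs (code gs x).
have fM: {in <<[set x in gs]>> &, {morph f : x y / x * y}}.
  move=> x y /(elt_surj sat_gs size_gs)[j ltj ->{x}].
  case/(elt_surj sat_gs size_gs)=> k ltk ->{y}.
  have lt_jk := scan_lt (normal_form_wf k) ltj.
  by rewrite (elt_mul sat_gs) // /f !eltK // (elt_mul sat_hs).
by exists (Morphism fM) => k ltk; rewrite /= /f eltK.
Qed.

End Complete.

(** The word of k extends, by one generator, the word of the origin of the
first edge that ends at k. The codes below are numbered breadth first, so this
origin is smaller than k. *)
Definition tree_normal_forms : seq word :=
  let spell ws' k :=
    let e := nth (0, 0) edges (find (fun e => target e == k) edges) in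
    rcons ws' (rcons (nth [::] ws' e.1) (false, e.2)) in
  foldl spell [:: [::]] (iota 1 n.-1).

End Table.

(** * The group defined by a complete table *)

Section Model.

Variables (m : nat) (cols : seq (seq nat)) (ws rels : seq word).
Hypothesis tab : complete_table m.+1 cols ws rels.

(** The columns are permutations of the codes; they generate the regular
representation of the presented group. *)
Definition column_permutation (c : seq nat) : {perm 'I_m.+1} :=
  insubd (1 : {perm 'I_m.+1}) [ffun i : 'I_m.+1 => inord (nth 0 c i)].

Lemma column_permutationE c (i : 'I_m.+1) :
  perm_eq c (iota 0 m.+1) -> column_permutation c i = nth 0 c i :> nat.
Proof.
move=> c_perm; have c_lt (j : 'I_m.+1) : nth 0 c j < m.+1.
  have: nth 0 c j \in c.
    by rewrite mem_nth // (perm_size c_perm) size_iota.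
  by rewrite (perm_mem c_perm) mem_iota.
rewrite /column_permutation unlock /= val_insubd ifT ?ffunE ?inordK //.
apply/injectiveP=> j k; rewrite !ffunE => /(congr1 (@nat_of_ord _)).
rewrite !inordK // => /eqP; rewrite nth_uniq ?(perm_size c_perm) ?size_iota //.
  by move/eqP/val_inj.
by rewrite (perm_uniq c_perm) iota_uniq.
Qed.

Definition model := map column_permutation cols.

Lemma model_word u (k : 'I_m.+1) :
  well_formed cols u -> word_value model u k = scan cols k u :> nat.
Proof.
elim: u k => [|[b i] u IHu] k /=; first by rewrite perm1.
case/andP=> lti wu; rewrite permM IHu //; congr scan.
rewrite /letter_value /step (nth_map [::]) //=.
have col_i := column_permutationE _ (column_perm tab lti).
case: b; last exact: col_i.
set s := column_permutation _; rewrite -{2}(permKV s k) col_i index_uniq //.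
  by rewrite (size_column tab).
by rewrite (perm_uniq (column_perm tab lti)) iota_uniq.
Qed.

Lemma model_satisfies : satisfies model rels.
Proof.
case/and5P: tab => _ _ /allP wfr /allP clr _; apply/allP=> r r_in.
apply/eqP/permP=> k; apply/ord_inj; rewrite model_word ?wfr // perm1.
by have/allP/(_ k) := clr r r_in; rewrite mem_iota ltn_ord => /(_ isT)/eqP.
Qed.

(** The permutations given by the words send 0 to distinct codes. *)
Lemma model_large : m.+1 <= #|<<[set x in model]>>|.
Proof.
have inj: injective (fun k : 'I_m.+1 => elt ws model k).
  move=> j k /= /(congr1 (fun s : {perm _} => nat_of_ord (s ord0))).
  rewrite /elt !model_word ?(normal_form_wf tab) // !(scan_normal_form tab) //.
  exact: ord_inj.
rewrite -[X in X <= _]card_ord -(card_imset _ inj) subset_leq_card //.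
by apply/subsetP=> _ /imsetP[k _ ->]; apply: elt_gen.
Qed.

End Model.

Section Presented.

Variables (n : nat) (cols : seq (seq nat)) (ws : seq word).
Variable (p : Presentation.term -> Presentation.type).
Hypothesis tab : complete_table n cols ws (relators p).
Hypothesis arity_p : size cols = arity p.

(** The model satisfies the relations, so it is an image of the group. *)
Lemma presentation_large (gT : finGroupType) (G : {group gT}) :
  G \isog Grp p -> n <= #|G|.
Proof.
move=> isoG; case: n tab (table_gt0 tab) => // m tab' _.
apply: leq_trans (model_large tab') (leq_homg _); rewrite isoG.
apply/homGrpE; exists (model m cols).
by rewrite size_map (model_satisfies tab').
Qed.

Lemma presentation_ex :
  exists (gT : finGroupType) (G : {group gT}) (gs : seq gT),
    [/\ G \isog Grp p, size gs = arity p, <<[set x in gs]>> = G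
      & satisfies gs (relators p)].
Proof.
case: n tab (table_gt0 tab) => // m tab' _.
have sat := model_satisfies tab'; have large := model_large tab'.
exists _, <<[set x in model m cols]>>%G, (model m cols).
split=> //; last by rewrite size_map.
apply: intro_isoGrp => [|rT H /homGrpE[hs [size_hs defH sat_hs]]].
  by apply/homGrpE; exists (model m cols); rewrite size_map.
have size_gs : size (model m cols) = size cols by rewrite size_map.
rewrite -arity_p in size_hs.
have [f fE] := von_dyck tab' sat size_gs large sat_hs.
apply/homgP; exists f; apply/eqP; rewrite eqEsubset; apply/andP; split.
  apply/subsetP=> _ /morphimP[x _ /(elt_surj tab' sat size_gs)[k ltk ->] ->].
  by rewrite fE // -defH elt_gen.
apply/subsetP=> y; rewrite -defH => /(elt_surj tab' sat_hs size_hs)[k ltk ->].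
by rewrite -fE // mem_morphim ?elt_gen.
Qed.

End Presented.

(** * Cayley index and stabilisers *)

Section Stabiliser.

Variables (gT : finGroupType) (G : {group gT}).
Implicit Types (S : {set gT}) (s : {perm gT}).

Lemma cayley_relE S x y : cayley_rel G S x y = (x \in G) && (x^-1 * y \in S).
Proof.
rewrite /cayley_rel /=; congr (_ && _); apply/exists_inP/idP.
  by case=> t St /eqP->; rewrite mulKg.
by move=> St; exists (x^-1 * y); rewrite ?mulKVg.
Qed.

Definition vertex_stabiliser S :=
  [set s in graph_aut G (cayley_rel G S) | s 1 == 1].

Lemma vertex_stabiliserP S s :
  reflect [/\ perm_on G s, s 1 = 1
            & {in G &, forall x y,
                cayley_rel G S (s x) (s y) = cayley_rel G S x y}]
          (s \in vertex_stabiliser S).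
Proof.
rewrite !inE; apply: (iffP andP) => [[/andP[Gs rel_s] /eqP s1]|[Gs s1 rel_s]].
  split=> // x y Gx Gy.
  by have/forall_inP/(_ x Gx)/forall_inP/(_ y Gy)/eqP := rel_s.
rewrite s1 Gs eqxx; split=> //=.
by apply/forall_inP=> x Gx; apply/forall_inP=> y Gy; rewrite rel_s.
Qed.

Lemma left_translation g :
  g \in G -> exists2 s, s \in left_regular G & s 1 = g.
Proof.
move=> Gg; have gG: [set g * x | x in G] \subset G.
  by apply/subsetP=> _ /imsetP[x Gx ->]; rewrite groupM.
exists (perm_in (in2W (@mulgI _ g)) gG); last by rewrite perm_inE ?mulg1.
rewrite inE perm_in_on; apply/exists_inP; exists g => //.
by apply/forall_inP=> x Gx; rewrite perm_inE.
Qed.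

(** Left translations are transitive on the vertices, so this is the
orbit-stabiliser theorem. *)
Lemma cayley_index_stabiliser S : cayley_index G S = #|vertex_stabiliser S|.
Proof.
pose A := graph_aut_group G (cayley_rel G S).
have defO: orbit 'P A 1 = G.
  apply/setP=> x; apply/orbitP/idP => [[s] | Gx].
    by rewrite inE => /andP[Gs _] <-; rewrite /= /aperm perm_closed.
  have [s Ls s1] := left_translation Gx; exists s; rewrite //= ?s1 //.
  exact: (subsetP (left_regular_sub G S)).
have defC: 'C_A[1 | 'P] = vertex_stabiliser S.
  by apply/setP=> s; rewrite !inE sub1set inE.
rewrite /cayley_index -[LHS](divgS (left_regular_sub G S)) card_left_regular.
have := card_orbit_stab 'P A 1; rewrite defO defC => /= <-.
by rewrite mulKn.
Qed.

(** A group automorphism maps x^-1 * y to the corresponding quotient of the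
images, and x, y are adjacent when this quotient is in S. *)
Lemma Aut_vertex_stabiliser S s :
    s \in Aut G -> {in G, forall x, (s x \in S) = (x \in S)} ->
  s \in vertex_stabiliser S.
Proof.
move=> As sS; have sE := autmE As; have closed := Aut_closed As.
have /setIdP[Gs _] := As.
have s1: s 1 = 1 by rewrite -sE morph1.
apply/vertex_stabiliserP; split=> // x y Gx Gy.
rewrite !cayley_relE closed // Gx /= -[RHS]sS ?groupM ?groupV //.
by rewrite -sE morphM ?groupV ?morphV.
Qed.

Lemma Aut_cayley_index_gt1 S s :
    s \in Aut G -> s != 1 -> {in G, forall x, (s x \in S) = (x \in S)} ->
  1 < cayley_index G S.
Proof.
move=> As ntrivial sS; rewrite cayley_index_stabiliser.
have stab1: 1 \in vertex_stabiliser S.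
  by apply: Aut_vertex_stabiliser => [|x _]; rewrite ?group1 ?perm1.
have/subset_leq_card: [set s; 1] \subset vertex_stabiliser S.
  by rewrite subUset !sub1set stab1 Aut_vertex_stabiliser.
by rewrite cards2 ntrivial.
Qed.

Lemma index_two_witnessI S :
    connection_set G S -> #|vertex_stabiliser S| <= 2 ->
    (forall S', connection_set G S' -> 1 < cayley_index G S') ->
  index_two_witness G S.
Proof.
move=> conS; rewrite -cayley_index_stabiliser => le2 gt1.
have [S0 conS0 minS0] := group_cayley_index_ex G.
have indS: cayley_index G S = 2 by apply/eqP; rewrite eqn_leq le2 gt1.
split=> //; apply/eqP; rewrite eqn_leq -{1}indS group_cayley_index_min //.
by rewrite minS0 gt1.
Qed.

End Stabiliser.

(** * Verifying Cayley index two by computation *)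

Section Certificate.

Variables (n : nat) (cols : seq (seq nat)) (ws rels conn : seq word).
Implicit Types (k : nat) (im : seq nat) (u : word) (c : seq (nat * nat)).

Definition neighbours k := [seq scan cols k u | u <- conn].

Definition connection_certificate :=
  all (fun u => [&& well_formed cols u, scan cols 0 u != 0
                  & scan cols 0 (inverse_word u) \in neighbours 0]) conn.

Definition adjacency_matrix : seq (seq bool) :=
  [seq let nbrs := neighbours j in [seq k \in nbrs | k <- iota 0 n]
     | j <- iota 0 n].

(** All maps from the codes in vs and 0 to codes that send 0 to 0, are
injective and preserve adjacency and its negation. The last code of vs is
mapped first. *)
Fixpoint partial_automorphisms (adj : seq (seq bool)) (vs : seq nat) :
    seq (seq (nat * nat)) :=
  if vs is j :: vs' then
    let fits f k :=
      all (fun e => (nth false (nth [::] adj e.1) j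
                       == nth false (nth [::] adj e.2) k) && (e.2 != k)) f in
    [seq (j, k) :: f | f <- partial_automorphisms adj vs',
                       k <- [seq k <- iota 0 n | fits f k]]
  else [:: [:: (0, 0)]].

(** Visiting neighbours early makes wrong choices fail early in the search. *)
Definition breadth_first_order :=
  let visit vs k := vs ++ [seq j <- neighbours (nth 0 vs k) | j \notin vs] in
  foldl visit [:: 0] (iota 0 n).

Definition rigidity_certificate :=
  let vs := rev (behead breadth_first_order) in
  perm_eq (0 :: vs) (iota 0 n)
  && (size (partial_automorphisms adjacency_matrix vs) <= 2).

(** The sequence im lists codes for the images of the generators, and a word
is rewritten by replacing every generator by the word of its image. *)
Definition substitute im u : word :=
  flatten [seq let v := normal_form ws (nth 0 im l.2) in
               if l.1 then inverse_word v else v | l <- u].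

Definition code_image im k := scan cols 0 (substitute im (normal_form ws k)).

Definition automorphism_certificate im :=
  let f := [seq code_image im k | k <- iota 0 n] in
  [&& all (fun r => scan cols 0 (substitute im r) == 0) rels,
      uniq f & f != iota 0 n].

(** An inverse-closed set contains x if and only if it contains x^-1; the
pair is represented by the smaller of the two codes. *)
Definition inverse_class k :=
  minn k (scan cols 0 (inverse_word (normal_form ws k))).

Definition class_table := [seq inverse_class k | k <- iota 0 n].

(** A connection set is invariant under an automorphism when membership
agrees on both entries of each of these pairs of classes. *)
Definition constraints (classes : seq nat) im :=
  undup [seq e <- [seq (nth 0 classes k, nth 0 classes (code_image im k))
                     | k <- iota 0 n] | e.1 != e.2].

(** A connection set never contains the identity, so the code 0 can stand for
the truth value false, and the unused code n for true; deciding whether the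
class k belongs to the set then identifies k with b = 0 or with b = n. *)
Definition assign k b c :=
  let value j := if j == k then b else j in
  [seq e <- [seq (value e.1, value e.2) | e <- c] | e.1 != e.2].

Definition contradictory c := ((0, n) \in c) || ((n, 0) \in c).

(** True only if each assignment of truth values to the classes satisfies all
constraints of some automorphism in the list. The branching is on a class that
occurs in the first remaining constraint, and automorphisms with a contradictory
constraint are dropped, since they cannot preserve the set. *)
Fixpoint covers depth (cs : seq (seq (nat * nat))) :=
  has (fun c => nilp c) cs ||
  match depth, cs with
  | depth'.+1, (e :: _) :: _ =>
    let k := if (e.1 == 0) || (e.1 == n) then e.2 else e.1 in
    let branch b := covers depth'
      [seq c <- [seq assign k b c | c <- cs] | ~~ contradictory c] in
    branch 0 && branch n
  | _, _ => false
  end.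

Definition automorphisms_certificate ims :=
  all automorphism_certificate ims
  && let classes := class_table in
     covers n [seq constraints classes im | im <- ims].

(** Following the branch that chi selects leads to an automorphism whose
constraints were all resolved in accordance with chi. *)
Lemma coversP (chi : nat -> bool) depth cs :
    chi 0 = false -> chi n -> covers depth cs ->
  exists2 c, c \in cs & {in c, forall e, chi e.1 = chi e.2}.
Proof.
move=> chi0 chin; elim: depth cs => [|d IHd] cs /=.
  by rewrite orbF => /hasP[[] // cs_nil _]; exists [::].
case/orP=> [/hasP[[] // cs_nil _]|]; first by exists [::].
case: cs => [|[|e0 c0] cs] //.
set cs' := _ :: cs; set k := if _ then _ else _; move: cs' k => {}cs k branches.
pose b := if chi k then n else 0.
have{branches} /IHd[c']: covers d
    [seq c <- [seq assign k b c | c <- cs] | ~~ contradictory c].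
  by rewrite /b; case: ifP => _; case/andP: branches.
rewrite mem_filter => /andP[_ /mapP[c cs_c ->{c'}]] chi_c; exists c => // e c_e.
have chiE j : chi (if j == k then b else j) = chi j.
  by case: eqP => // ->; rewrite /b; case: ifP.
set value := fun j => if j == k then b else j.
have [eq_e | neq_e] := eqVneq (value e.1) (value e.2).
  by rewrite -chiE -[RHS]chiE -/(value _) eq_e.
have := chi_c (value e.1, value e.2); rewrite mem_filter neq_e /= !chiE; apply.
by apply/mapP; exists e.
Qed.

Hypothesis tab : complete_table n cols ws rels.

Variables (gT : finGroupType) (gs : seq gT) (G : {group gT}).
Hypotheses (sat : satisfies gs rels) (size_gs : size gs = size cols).
Hypotheses (gen : <<[set x in gs]>> = G) (large : n <= #|G|).

Local Notation el := (elt ws gs).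
Local Notation cd := (code n ws gs).

Let large' : n <= #|<<[set x in gs]>>|. Proof. by rewrite gen. Qed.

Let el_in k : el k \in G. Proof. by rewrite -gen elt_gen. Qed.

Let el_surj x : x \in G -> exists2 k, k < n & x = el k.
Proof. by rewrite -gen; apply: (elt_surj tab sat size_gs). Qed.

Let cdK x : x \in G -> el (cd x) = x.
Proof. by rewrite -gen; apply: (codeK tab sat size_gs). Qed.

Let cd_lt x : x \in G -> cd x < n.
Proof. by rewrite -gen; apply: (code_lt tab sat size_gs). Qed.

Let el_inj j k : j < n -> k < n -> el j = el k -> j = k.
Proof. exact: (elt_inj tab sat size_gs large'). Qed.

Let elK k : k < n -> cd (el k) = k.
Proof. exact: (eltK tab sat size_gs large'). Qed.

Let el0 : el 0 = 1. Proof. exact: (elt0 tab). Qed.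

Definition connection := [set x in [seq word_value gs u | u <- conn]].

Section Connection.

Hypothesis conn_ok : connection_certificate.

Let conn_wf u : u \in conn -> well_formed cols u.
Proof. by move/(allP conn_ok)/and3P=> []. Qed.

(** Adjacency in the Cayley graph is computed by scanning the words of the
connection set. *)
Lemma connection_elt j k :
  j < n -> k < n -> ((el j)^-1 * el k \in connection) = (k \in neighbours j).
Proof.
move=> ltj ltk; rewrite inE; apply/mapP/mapP=> -[u conn_u eq_u]; exists u => //.
  apply: el_inj => //; first by rewrite (scan_lt tab) ?conn_wf.
  by rewrite -(elt_scan tab) ?conn_wf // -eq_u mulKVg.
by rewrite eq_u -(elt_scan tab) ?conn_wf ?mulKg.
Qed.

Lemma connectionP : connection_set G connection.
Proof.
have n_gt0 := table_gt0 tab.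
have connE k : k < n -> (el k \in connection) = (k \in neighbours 0).
  by move=> ltk; rewrite -connection_elt // el0 invg1 mul1g.
have subV: connection \subset connection^-1.
  apply/subsetP=> x; rewrite inE => /mapP[u conn_u ->].
  have /and3P[wu _] := allP conn_ok u conn_u; have wu' := inverse_wf wu.
  by rewrite inE -word_value_inverse (elt_word tab) // connE ?(scan_lt tab).
apply/and3P; split.
- apply/subsetP=> _ /[!inE] /mapP[u _ ->]; rewrite -gen; exact: word_value_gen.
- by rewrite eq_sym eqEsubset subV -invSg invgK subV.
rewrite -el0 connE //; apply/mapP=> -[u /(allP conn_ok)/and3P[_ + _] eq0].
by rewrite -eq0.
Qed.

Lemma nth_adjacency j k : j < n -> k < n ->
  nth false (nth [::] adjacency_matrix j) k
    = ((el j)^-1 * el k \in connection).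
Proof.
move=> ltj ltk; rewrite connection_elt // (nth_map 0) ?size_iota //.
by rewrite (nth_map 0) ?size_iota // !nth_iota.
Qed.

(** No automorphism that fixes the identity escapes the search. *)
Lemma mem_partial_automorphisms vs s :
    s \in vertex_stabiliser G connection ->
    uniq vs -> 0 \notin vs -> {in vs, forall k, k < n} ->
  rcons [seq (k, cd (s (el k))) | k <- vs] (0, 0)
    \in partial_automorphisms adjacency_matrix vs.
Proof.
case/vertex_stabiliserP=> Gs s1 rel_s; elim: vs => [|j vs IHvs] //=.
case/andP=> vs_j uniq_vs; rewrite inE negb_or => /andP[j_neq0 vs_0] vs_lt.
have {}IHvs: rcons [seq (k, cd (s (el k))) | k <- vs] (0, 0)
    \in partial_automorphisms adjacency_matrix vs.
  by apply: IHvs => // k vs_k; rewrite vs_lt // inE vs_k orbT.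
have sG k : s (el k) \in G by rewrite perm_closed.
have ltj: j < n by rewrite vs_lt ?mem_head.
apply/allpairsPdep; exists (rcons [seq (k, cd (s (el k))) | k <- vs] (0, 0)).
exists (cd (s (el j))); split=> //.
rewrite mem_filter mem_iota leq0n cd_lt // !andbT.
have fits k : k < n -> k != j ->
  (nth false (nth [::] adjacency_matrix k) j
    == nth false (nth [::] adjacency_matrix (cd (s (el k)))) (cd (s (el j))))
  && (cd (s (el k)) != cd (s (el j))).
- move=> ltk neq_kj; rewrite !nth_adjacency ?cd_lt // !cdK //.
  have := rel_s (el k) (el j) (el_in k) (el_in j).
  rewrite !cayley_relE sG el_in /= => ->; rewrite eqxx /=.
  apply: contra neq_kj => /eqP/(congr1 el); rewrite !cdK // => /perm_inj.
  by move/(el_inj ltk ltj)/eqP.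
apply/allP=> e; rewrite mem_rcons inE => /predU1P[-> | /mapP[k vs_k ->]] /=.
  have := fits 0 (table_gt0 tab) j_neq0.
  by rewrite el0 s1 -el0 elK ?(table_gt0 tab).
apply: fits; first by rewrite vs_lt // inE vs_k orbT.
by apply: contraNneq vs_j => <-.
Qed.

Lemma rigid_stabiliser :
  rigidity_certificate -> #|vertex_stabiliser G connection| <= 2.
Proof.
rewrite /rigidity_certificate; set vs := rev _ => /andP[perm_vs le2].
have vsE k : (k \in 0 :: vs) = (k < n) by rewrite (perm_mem perm_vs) mem_iota.
have := perm_uniq perm_vs; rewrite iota_uniq => /= /andP[vs_0 uniq_vs].
pose F (s : {perm gT}) := rcons [seq (k, cd (s (el k))) | k <- vs] (0, 0).
have injF: {in vertex_stabiliser G connection &, injective F}.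
  move=> s t Vs Vt /rcons_inj[/eq_in_map eq_st].
  have [Gs s1 _] := vertex_stabiliserP _ _ _ Vs.
  have [Gt t1 _] := vertex_stabiliserP _ _ _ Vt.
  apply/permP=> x; have [Gx | G'x] := boolP (x \in G); last first.
    by rewrite (out_perm Gs) ?(out_perm Gt).
  have [k ltk ->] := el_surj Gx.
  move: ltk; rewrite -vsE inE => /predU1P[-> | vs_k].
    by rewrite el0 s1 t1.
  have [/(congr1 el)] := eq_st k vs_k.
  by rewrite !cdK ?perm_closed.
apply: leq_trans le2; rewrite cardE -(size_map F); apply: uniq_leq_size.
  rewrite map_inj_in_uniq ?enum_uniq // => s t.
  by rewrite !mem_enum; apply: injF.
move=> _ /mapP[s + ->]; rewrite mem_enum => Vs.
apply: mem_partial_automorphisms => // k vs_k.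
by rewrite -vsE inE vs_k orbT.
Qed.

End Connection.

Lemma word_value_substitute im u :
  word_value [seq el k | k <- im] u = word_value gs (substitute im u).
Proof.
elim: u => //= -[b i] u ->; rewrite /substitute /= word_value_cat.
congr (_ * _); rewrite /letter_value /=.
have ->: nth 1 [seq el k | k <- im] i = el (nth 0 im i).
  have [lti | lei] := ltnP i (size im); first by rewrite (nth_map 0).
  by rewrite !nth_default ?size_map.
by case: b; rewrite ?word_value_inverse.
Qed.

Lemma substitute_wf im u : well_formed cols (substitute im u).
Proof.
rewrite /substitute; elim: u => //= l u IHu; rewrite /well_formed all_cat.
apply/andP; split=> //; case: ifP => _; last exact: (normal_form_wf tab).
exact/inverse_wf/(normal_form_wf tab).
Qed.

Lemma code_image_lt im k : code_image im k < n.
Proof. by rewrite (scan_lt tab) ?substitute_wf ?(table_gt0 tab). Qed.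

(** The images satisfy the relations, so they define an endomorphism, which is
injective because the codes of the images are distinct. *)
Lemma certified_automorphism im :
    automorphism_certificate im ->
  exists2 s : {perm gT}, s \in Aut G & s != 1
    /\ forall k, k < n -> s (el k) = el (code_image im k).
Proof.
case/and3P=> im_rels im_uniq im_nontrivial.
have sat_im: satisfies [seq el k | k <- im] rels.
  apply/allP=> r /(allP im_rels)/eqP im_r; rewrite word_value_substitute.
  by rewrite (elt_word tab) ?substitute_wf // im_r el0.
have := von_dyck tab sat size_gs large' sat_im; rewrite gen => -[f fE].
have {}fE k : k < n -> f (el k) = el (code_image im k).
  move/fE->; rewrite [LHS]word_value_substitute.
  by rewrite (elt_word tab) ?substitute_wf.
have injf: 'injm f.
  apply/injmP=> _ _ /el_surj[j ltj ->] /el_surj[k ltk ->]; rewrite !fE //.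
  move/(el_inj (code_image_lt _ _) (code_image_lt _ _)).
  have nthE i : i < n ->
    code_image im i = nth 0 [seq code_image im k | k <- iota 0 n] i.
    by move=> lti; rewrite (nth_map 0) ?size_iota ?nth_iota.
  rewrite !nthE // => /eqP; rewrite nth_uniq ?size_map ?size_iota //.
  by move/eqP->.
have imf: f @* G = G.
  apply/eqP; rewrite eqEcard card_injm // leqnn andbT.
  by apply/subsetP=> _ /morphimP[_ _ /el_surj[k ltk ->] ->]; rewrite fE.
have sE k : k < n -> aut injf imf (el k) = el (code_image im k).
  by move=> ltk; rewrite autE ?fE.
exists (aut injf imf); rewrite ?Aut_aut //; split=> //.
apply: contra im_nontrivial => /eqP s1; apply/eqP.
rewrite -[RHS]map_id; apply/eq_in_map=> k; rewrite mem_iota => /= ltk.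
by apply: el_inj; rewrite ?code_image_lt // -sE // s1 perm1.
Qed.

(** The characteristic function of the connection set satisfies the
constraints of some automorphism in the list, which then preserves the set. *)
Lemma certified_lower_bound ims S :
    automorphisms_certificate ims -> connection_set G S ->
  1 < cayley_index G S.
Proof.
case/andP=> /allP ims_aut cov /and3P[sSG /eqP SV S1].
(* The first disjunct gives the code n its role as the truth value true. *)
pose chi k := (k == n) || (el k \in S).
have chi_class k : k < n -> chi (inverse_class k) = (el k \in S).
  move=> ltk; have wf_k := normal_form_wf tab k.
  have el_inv: el (scan cols 0 (inverse_word (normal_form ws k))) = (el k)^-1.
    by rewrite -(elt_word tab) ?inverse_wf // word_value_inverse.
  rewrite /chi /inverse_class /minn ltn_eqF; last first.
    by case: ifP => // _; rewrite (scan_lt tab) ?inverse_wf ?(table_gt0 tab).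
  by case: ifP => // _; rewrite el_inv -mem_invg SV.
have [|| c /mapP[im ims_im ->] chi_c] := coversP _ _ cov (chi := chi).
- by rewrite /chi el0 (negPf S1) orbF eq_sym gtn_eqF ?(table_gt0 tab).
- by rewrite /chi eqxx.
have [s As [s_neq1 sE]] := certified_automorphism (ims_aut im ims_im).
apply: Aut_cayley_index_gt1 As s_neq1 _ => _ /el_surj[k ltk ->].
rewrite sE // -!chi_class ?code_image_lt //.
have classE j : j < n -> nth 0 class_table j = inverse_class j.
  by move=> ltj; rewrite (nth_map 0) ?size_iota // nth_iota.
rewrite -!classE ?code_image_lt //.
set e1 := nth _ _ (code_image _ _); set e2 := nth _ _ _.
have [-> // | neq_e] := eqVneq e2 e1.
symmetry; apply: (chi_c (e2, e1)).
rewrite mem_undup mem_filter neq_e; apply/mapP; exists k => //.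
by rewrite mem_iota.
Qed.

End Certificate.

Definition certificate n (p : Presentation.term -> Presentation.type) cols
    (ts : seq Presentation.term) ims :=
  let ws := tree_normal_forms n cols in
  let rels := relators p in
  let conn := [seq word_of_term t | t <- ts] in
  [&& complete_table n cols ws rels, connection_certificate cols conn,
      rigidity_certificate n cols conn
    & automorphisms_certificate n cols ws rels ims].

Theorem certified_index_two n p cols ts ims
    (gT : finGroupType) (G : {group gT}) (gs : seq gT) :
    certificate n p cols ts ims ->
    satisfies gs (relators p) -> size gs = size cols ->
    <<[set x in gs]>> = G -> n <= #|G| ->
  index_two_witness G [set x in [seq Presentation.eval gs t | t <- ts]].
Proof.
case/and4P=> tab conn_ok rigid auts sat size_gs gen large.
rewrite -(eq_map (word_of_termE gs)) map_comp.
apply: index_two_witnessI.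
- exact: (connectionP tab sat size_gs gen large conn_ok).
- exact: (rigid_stabiliser tab sat size_gs gen large conn_ok).
by move=> S; apply: (certified_lower_bound tab sat size_gs gen large auts).
Qed.

(** * Tables and automorphisms of the groups *)

Section Presentations.

Import Presentation.

(** The relations are entered in the syntax of [Grp], so that being isomorphic
to a presented group is convertible to a statement about a named presentation.
The connection sets are entered as terms in the same generators. *)
Local Notation "'Pres' ( x : p )" := (fun x => Cast p)
  (x ident, p custom group_presentation at level 200).

Local Notation "'Terms' ( t1 , .. , t2 )" := (cons t1 .. (cons t2 nil) ..)
  (t1 custom group_presentation at level 100,
   t2 custom group_presentation at level 100).

Let a := Cst 0.
Let b := Cst 1.
Let c := Cst 2.

Definition dihedral_presentation n :=
  Pres (a : b : a ^+ 2, b ^+ n, a * b * a = b^-1).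

Definition dihedral_connection := Terms (a, a * b).

Definition A4_presentation := Pres (a : b : a ^+ 3, b ^+ 2, (a * b) ^+ 3).

Definition A4_connection := Terms (a, a^-1, b).

Definition H1_presentation :=
  Pres (a : b : c : a ^+ 2, b ^+ 2, c ^+ 2,
        a * b * c = b * c * a = c * a * b).

Definition H1_connection := Terms (a, b, c, a * b, (a * b)^-1).

Definition H2_presentation :=
  Pres (a : b : a ^+ 8, b ^+ 2, b * a * b = a ^+ 5).

Definition H2_connection := Terms (a, a^-1, a ^+ 2, a ^- 2, b).

Definition H3_presentation :=
  Pres (a : b : c : a ^+ 3, b ^+ 3, c ^+ 2, a * b = b * a,
        (a * c) ^+ 2, (b * c) ^+ 2).

Definition H3_connection := Terms (a, a^-1, c, a * c, b * c).

Definition H4_presentation :=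
  Pres (a : b : c : a ^+ 3, b ^+ 3, c ^+ 3, a * c = c * a, b * c = c * b,
        b^-1 * a * b = a * c).

Definition H4_connection :=
  Terms (a, a^-1, b, b^-1, a^-1 * b, (a^-1 * b)^-1,
         b * a * b^-1, (b * a * b^-1)^-1).

Definition Q8_presentation :=
  Pres (a : b : a ^+ 4, b ^+ 2 = a ^+ 2, a ^ b = a^-1).

Definition Q8xZ_presentation n :=
  Pres (a : b : c : a ^+ 4, b ^+ 2 = a ^+ 2, a ^ b = a^-1, c ^+ n,
        a * c = c * a, b * c = c * b).

Definition Q8xZ3_connection :=
  Terms (a, a ^+ 2 * a, a * c, (a * c)^-1, b * c, (b * c)^-1).

Definition Q8xZ4_connection :=
  Terms (c, c^-1, a, a ^+ 2 * a, b, a ^+ 2 * b, a * c, (a * c)^-1,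
         a ^+ 2 * (a * b) * c, (a ^+ 2 * (a * b) * c)^-1).

End Presentations.

(** Each table lists the columns of a regular representation, and each
automorphism the codes of the images of the generators. The automorphisms were
selected greedily so that every connection set is invariant under one of
them. *)

Definition D3_table :=
  ([:: [:: 1; 0; 4; 5; 2; 3];
      [:: 2; 3; 5; 4; 1; 0]])%N.

Definition D3_automorphisms :=
  ([:: [:: 1; 5]; [:: 3; 5]; [:: 4; 5]])%N.

Lemma D3_certificate :
  certificate 6 (dihedral_presentation 3) D3_table dihedral_connection
    D3_automorphisms.
Proof. by vm_compute. Qed.

Definition D4_table :=
  ([:: [:: 1; 0; 4; 6; 2; 7; 3; 5];
      [:: 2; 3; 5; 7; 1; 6; 0; 4]])%N.

Definition D4_automorphisms :=
  ([:: [:: 1; 6]; [:: 3; 6]; [:: 4; 6]; [:: 7; 6]])%N.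

Lemma D4_certificate :
  certificate 8 (dihedral_presentation 4) D4_table dihedral_connection
    D4_automorphisms.
Proof. by vm_compute. Qed.

Definition D5_table :=
  ([:: [:: 1; 0; 4; 6; 2; 8; 3; 9; 5; 7];
      [:: 2; 3; 5; 7; 1; 9; 0; 8; 4; 6]])%N.

Definition D5_automorphisms :=
  ([:: [:: 1; 6]; [:: 3; 6]; [:: 4; 6]; [:: 7; 6]; [:: 8; 6]])%N.

Lemma D5_certificate :
  certificate 10 (dihedral_presentation 5) D5_table dihedral_connection
    D5_automorphisms.
Proof. by vm_compute. Qed.

Definition A4_table :=
  ([:: [:: 1; 3; 5; 0; 7; 8; 10; 11; 2; 6; 9; 4];
      [:: 2; 4; 0; 6; 1; 9; 3; 8; 7; 5; 11; 10]])%N.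

Definition A4_automorphisms :=
  ([:: [:: 3; 2]; [:: 3; 10]; [:: 3; 11]; [:: 4; 2]; [:: 5; 2]; [:: 6; 10];
       [:: 7; 2]; [:: 8; 11]; [:: 9; 2]])%N.

Lemma A4_certificate :
  certificate 12 A4_presentation A4_table A4_connection
    A4_automorphisms.
Proof. by vm_compute. Qed.

Definition H1_table :=
  ([:: [:: 1; 0; 6; 8; 10; 12; 2; 11; 3; 13; 4; 7; 5; 9; 15; 14];
      [:: 2; 4; 0; 9; 1; 13; 14; 12; 11; 3; 15; 8; 7; 5; 6; 10];
      [:: 3; 5; 7; 0; 11; 1; 13; 2; 14; 10; 9; 4; 15; 6; 8; 12]])%N.

Definition H1_automorphisms :=
  ([:: [:: 1; 2; 12]; [:: 1; 3; 2]; [:: 1; 10; 3]; [:: 1; 12; 10];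
       [:: 2; 1; 3]; [:: 3; 2; 1]; [:: 10; 14; 3]; [:: 12; 2; 14];
       [:: 14; 2; 3]])%N.

Lemma H1_certificate :
  certificate 16 H1_presentation H1_table H1_connection
    H1_automorphisms.
Proof. by vm_compute. Qed.

Definition H2_table :=
  ([:: [:: 1; 3; 5; 6; 8; 7; 10; 12; 11; 13; 9; 2; 14; 15; 4; 0];
      [:: 2; 4; 0; 7; 1; 9; 11; 3; 13; 5; 14; 6; 15; 8; 10; 12]])%N.

Definition H2_automorphisms :=
  ([:: [:: 4; 2]; [:: 5; 2]; [:: 6; 2]; [:: 15; 2]; [:: 15; 14]])%N.

Lemma H2_certificate :
  certificate 16 H2_presentation H2_table H2_connection
    H2_automorphisms.
Proof. by vm_compute. Qed.

Definition H3_table :=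
  ([:: [:: 1; 4; 5; 9; 0; 11; 3; 12; 15; 6; 16; 2; 17; 8; 10; 13; 14; 7];
      [:: 2; 5; 7; 10; 11; 12; 14; 0; 3; 16; 8; 17; 1; 6; 13; 9; 15; 4];
      [:: 3; 6; 8; 0; 9; 13; 1; 10; 2; 4; 7; 15; 14; 5; 12; 11; 17; 16]])%N.

Definition H3_automorphisms :=
  ([:: [:: 1; 7; 3]; [:: 1; 7; 8]; [:: 1; 7; 10]; [:: 1; 12; 3];
       [:: 1; 12; 13]; [:: 1; 12; 16]; [:: 1; 17; 3]; [:: 1; 17; 14];
       [:: 1; 17; 15]; [:: 2; 1; 3]; [:: 2; 1; 14]; [:: 2; 1; 15];
       [:: 4; 2; 3]; [:: 4; 2; 6]; [:: 4; 2; 9]; [:: 4; 5; 3]; [:: 4; 5; 6];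
       [:: 4; 5; 9]; [:: 4; 7; 3]; [:: 4; 7; 6]; [:: 4; 7; 8]; [:: 4; 7; 9];
       [:: 4; 7; 10]; [:: 4; 7; 13]; [:: 4; 7; 14]; [:: 4; 7; 15];
       [:: 4; 7; 16]; [:: 4; 11; 3]; [:: 4; 11; 6]; [:: 4; 11; 9];
       [:: 5; 7; 3]; [:: 5; 7; 8]; [:: 5; 7; 10]; [:: 7; 4; 3]; [:: 7; 4; 13];
       [:: 7; 4; 16]; [:: 11; 2; 3]; [:: 11; 2; 13]; [:: 11; 2; 16];
       [:: 12; 7; 3]; [:: 12; 7; 8]; [:: 12; 7; 10]; [:: 17; 2; 3];
       [:: 17; 2; 14]; [:: 17; 2; 15]])%N.

Lemma H3_certificate :
  certificate 18 H3_presentation H3_table H3_connection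
    H3_automorphisms.
Proof. by vm_compute. Qed.

Definition H4_table :=
  ([:: [:: 1; 4; 7; 6; 0; 13; 12; 17; 19; 5; 16; 21; 3; 9; 25; 11; 23; 2; 22;
           24; 18; 15; 20; 10; 8; 26; 14];
      [:: 2; 5; 8; 9; 11; 14; 15; 18; 0; 20; 21; 22; 17; 24; 1; 19; 7; 25; 16;
           6; 3; 26; 4; 13; 23; 12; 10];
      [:: 3; 6; 9; 10; 12; 15; 16; 5; 20; 21; 0; 17; 23; 11; 19; 7; 1; 13; 14;
           18; 26; 2; 25; 4; 22; 24; 8]])%N.

Definition H4_automorphisms :=
  ([:: [:: 1; 8; 10]; [:: 1; 18; 10]; [:: 1; 25; 10]; [:: 2; 1; 10];
       [:: 4; 2; 10]; [:: 4; 5; 10]; [:: 4; 7; 10]; [:: 4; 8; 3];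
       [:: 4; 9; 10]; [:: 4; 11; 10]; [:: 4; 13; 10]; [:: 4; 15; 10];
       [:: 4; 17; 10]; [:: 4; 20; 3]; [:: 4; 21; 10]; [:: 4; 26; 3];
       [:: 5; 8; 10]; [:: 6; 8; 10]; [:: 6; 19; 10]; [:: 6; 24; 10];
       [:: 7; 8; 10]; [:: 8; 4; 10]; [:: 9; 6; 10]; [:: 11; 21; 10];
       [:: 12; 8; 3]; [:: 12; 20; 3]; [:: 12; 26; 3]; [:: 13; 2; 10];
       [:: 14; 8; 10]; [:: 15; 8; 10]; [:: 16; 8; 10]; [:: 16; 14; 10];
       [:: 16; 22; 10]; [:: 17; 9; 10]; [:: 18; 8; 10]; [:: 19; 8; 10];
       [:: 20; 23; 10]; [:: 21; 16; 10]; [:: 22; 21; 10]; [:: 23; 8; 3];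
       [:: 23; 20; 3]; [:: 23; 26; 3]; [:: 24; 9; 10]; [:: 25; 2; 10];
       [:: 26; 12; 10]])%N.

Lemma H4_certificate :
  certificate 27 H4_presentation H4_table H4_connection
    H4_automorphisms.
Proof. by vm_compute. Qed.

Definition Q8xZ3_table :=
  ([:: [:: 1; 4; 7; 6; 10; 2; 12; 11; 15; 14; 0; 5; 17; 8; 19; 18; 21; 3; 13;
           22; 16; 23; 9; 20];
      [:: 2; 5; 4; 8; 11; 10; 13; 1; 12; 16; 7; 0; 18; 17; 20; 6; 19; 15; 3;
           23; 22; 14; 21; 9];
      [:: 3; 6; 8; 9; 12; 13; 14; 15; 16; 0; 17; 18; 19; 20; 1; 21; 2; 22; 23;
           4; 5; 7; 10; 11]])%N.

Definition Q8xZ3_automorphisms :=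
  ([:: [:: 1; 11; 9]; [:: 2; 1; 9]; [:: 5; 11; 9]; [:: 7; 11; 9];
       [:: 10; 2; 9]; [:: 10; 5; 9]; [:: 10; 7; 9]; [:: 10; 11; 9];
       [:: 11; 10; 9]])%N.

Lemma Q8xZ3_certificate :
  certificate 24 (Q8xZ_presentation 3) Q8xZ3_table Q8xZ3_connection
    Q8xZ3_automorphisms.
Proof. by vm_compute. Qed.

Definition Q8xZ4_table :=
  ([:: [:: 1; 4; 7; 6; 10; 2; 12; 11; 15; 14; 0; 5; 18; 8; 20; 19; 23; 22; 3;
           13; 25; 16; 27; 26; 29; 9; 21; 30; 24; 31; 17; 28];
      [:: 2; 5; 4; 8; 11; 10; 13; 1; 12; 16; 7; 0; 19; 18; 21; 6; 20; 24; 15;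
           3; 26; 25; 28; 14; 27; 23; 9; 31; 30; 22; 29; 17];
      [:: 3; 6; 8; 9; 12; 13; 14; 15; 16; 17; 18; 19; 20; 21; 22; 23; 24; 0;
           25; 26; 27; 28; 1; 29; 2; 30; 31; 4; 5; 7; 10; 11]])%N.

Definition Q8xZ4_automorphisms :=
  ([:: [:: 1; 2; 27]; [:: 1; 11; 17]; [:: 1; 26; 3]; [:: 2; 1; 17];
       [:: 5; 11; 17]; [:: 7; 11; 17]; [:: 10; 2; 17]; [:: 10; 5; 17];
       [:: 10; 7; 17]; [:: 10; 11; 17]; [:: 10; 21; 17]; [:: 10; 23; 17];
       [:: 11; 10; 17]; [:: 16; 14; 17]; [:: 21; 11; 17]; [:: 23; 11; 17];
       [:: 25; 2; 3]; [:: 25; 26; 3]; [:: 26; 25; 17]])%N.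

Lemma Q8xZ4_certificate :
  certificate 32 (Q8xZ_presentation 4) Q8xZ4_table Q8xZ4_connection
    Q8xZ4_automorphisms.
Proof. by vm_compute. Qed.

Definition Q8_table :=
  ([:: [:: 1; 3; 5; 6; 2; 7; 0; 4];
      [:: 2; 4; 3; 7; 6; 1; 5; 0]])%N.

(** * From presentations to Cayley indices *)

Section Presented.

Variables (p : Presentation.term -> Presentation.type).

(** The common form of the hypotheses on named generators: the group has the
presentation, and the generators satisfy its relations. *)
Definition presented_by (gT : finGroupType) (G : {group gT}) (gs : seq gT) :=
  [/\ G \isog Grp p, size gs = arity p, <<[set x in gs]>> = G
    & satisfies gs (relators p)].

Lemma presented_index_two n cols ts ims :
    certificate n p cols ts ims -> size cols = arity p ->
  (exists (gT : finGroupType) (G : {group gT}) (gs : seq gT),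
    presented_by G gs)
  /\ (forall (gT : finGroupType) (G : {group gT}) (gs : seq gT),
    presented_by G gs ->
    #|G| = n /\
    index_two_witness G [set x in [seq Presentation.eval gs t | t <- ts]]).
Proof.
move=> cert arity_p; have [tab _ _ _] := and4P cert.
split; first exact: (presentation_ex tab arity_p).
move=> gT G gs [isoG size_gs gen sat]; rewrite -arity_p in size_gs.
have large := presentation_large tab arity_p isoG; split.
  by rewrite -gen (card_gen tab sat size_gs) // gen.
exact: certified_index_two cert sat size_gs gen large.
Qed.

End Presented.

Lemma dihedral_gensE (gT : finGroupType) (G : {group gT}) n a b :
  dihedral_gens G n a b <->
  presented_by (dihedral_presentation n) G [:: a; b].
Proof.
rewrite /presented_by satisfies_relators !(set_seq1, set_cons) /=.
split=> [[isoG gen [-> -> ->]] | [isoG _ gen]].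
  by rewrite !eqxx.
by case/and4P=> /eqP ? /eqP ? /eqP ? _.
Qed.

Lemma H1_gensE (gT : finGroupType) (G : {group gT}) a b c :
  H1_gens G a b c <->
  presented_by H1_presentation G [:: a; b; c].
Proof.
rewrite /presented_by satisfies_relators !(set_seq1, set_cons) setUA /=.
split=> [[isoG gen [-> -> -> -> ->]] | [isoG _ gen]].
  by rewrite !eqxx.
case/and5P=> /eqP ? /eqP ? /eqP ? /eqP e1 /andP[/eqP e2 _].
by split=> //; split; rewrite ?e1.
Qed.

Lemma H2_gensE (gT : finGroupType) (G : {group gT}) a b :
  H2_gens G a b <->
  presented_by H2_presentation G [:: a; b].
Proof.
rewrite /presented_by satisfies_relators !(set_seq1, set_cons) /=.
split=> [[isoG gen [-> -> ->]] | [isoG _ gen]].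
  by rewrite !eqxx.
by case/and4P=> /eqP ? /eqP ? /eqP ? _.
Qed.

Lemma H3_gensE (gT : finGroupType) (G : {group gT}) a b c :
  H3_gens G a b c <->
  presented_by H3_presentation G [:: a; b; c].
Proof.
rewrite /presented_by satisfies_relators !(set_seq1, set_cons) setUA /=.
split=> [[isoG gen [-> -> ->] [<- -> ->]] | [isoG _ gen]].
  by rewrite !eqxx.
by case/and5P=> /eqP ? /eqP ? /eqP ? /eqP ? /and3P[/eqP ? /eqP ? _].
Qed.

Lemma H4_gensE (gT : finGroupType) (G : {group gT}) a b c :
  H4_gens G a b c <->
  presented_by H4_presentation G [:: a; b; c].
Proof.
rewrite /presented_by satisfies_relators !(set_seq1, set_cons) setUA /=.
split=> [[isoG gen [-> -> ->] [-> -> ->]] | [isoG _ gen]].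
  by rewrite !eqxx.
by case/and5P=> /eqP ? /eqP ? /eqP ? /eqP ? /and3P[/eqP ? /eqP ? _].
Qed.

Lemma dihedral_index_two n : n \in [:: 3; 4; 5] ->
  (exists (gT : finGroupType) (G : {group gT}) (a b : gT),
     dihedral_gens G n a b)
  /\ (forall (gT : finGroupType) (G : {group gT}) (a b : gT),
     dihedral_gens G n a b ->
     #|G| = (2 * n)%N /\ index_two_witness G [set a; a * b]).
Proof.
move=> n345.
have [cols [ims cert size_cols]]: exists cols, exists2 ims,
    certificate (2 * n) (dihedral_presentation n) cols dihedral_connection ims
  & size cols = 2.
- move: n345; rewrite !inE => /or3P[]/eqP->.
  + exists D3_table, D3_automorphisms => //; exact: D3_certificate.
  + exists D4_table, D4_automorphisms => //; exact: D4_certificate.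
  exists D5_table, D5_automorphisms => //; exact: D5_certificate.
have [[gT [G [gs gensG]]] ind] := presented_index_two cert size_cols.
split.
  case: gs gensG => [|a [|b [|? ?]]] gensG; try by case: gensG.
  by exists gT, G, a, b; apply/dihedral_gensE.
move=> rT H x y /dihedral_gensE/ind[-> indH]; split=> //.
by move: indH; rewrite /= !(set_seq1, set_cons).
Qed.

Lemma H1_index_two :
  (exists (gT : finGroupType) (G : {group gT}) (a b c : gT), H1_gens G a b c)
  /\ (forall (gT : finGroupType) (G : {group gT}) (a b c : gT),
      H1_gens G a b c ->
      #|G| = 16 /\
      index_two_witness G [set a; b; c; a * b; (a * b)^-1]).
Proof.
have [//|[gT [G [gs gensG]]] ind] := presented_index_two H1_certificate.
split.
  case: gs gensG => [|a [|b [|c [|? ?]]]] gensG; try by case: gensG.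
  by exists gT, G, a, b, c; apply/H1_gensE.
move=> rT H x y z /H1_gensE/ind[-> indH]; split=> //.
by move: indH; rewrite /= !(set_seq1, set_cons) !setUA.
Qed.

Lemma H2_index_two :
  (exists (gT : finGroupType) (G : {group gT}) (a b : gT), H2_gens G a b)
   /\ (forall (gT : finGroupType) (G : {group gT}) (a b : gT),
       H2_gens G a b ->
       #|G| = 16 /\
       index_two_witness G [set a; a^-1; a ^+ 2; a ^- 2; b]).
Proof.
have [//|[gT [G [gs gensG]]] ind] := presented_index_two H2_certificate.
split.
  case: gs gensG => [|a [|b [|? ?]]] gensG; try by case: gensG.
  by exists gT, G, a, b; apply/H2_gensE.
move=> rT H x y /H2_gensE/ind[-> indH]; split=> //.
by move: indH; rewrite /= !(set_seq1, set_cons) !setUA.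
Qed.

Lemma H3_index_two :
  (exists (gT : finGroupType) (G : {group gT}) (a b c : gT), H3_gens G a b c)
   /\ (forall (gT : finGroupType) (G : {group gT}) (a b c : gT),
       H3_gens G a b c ->
       #|G| = 18 /\
       index_two_witness G [set a; a^-1; c; a * c; b * c]).
Proof.
have [//|[gT [G [gs gensG]]] ind] := presented_index_two H3_certificate.
split.
  case: gs gensG => [|a [|b [|c [|? ?]]]] gensG; try by case: gensG.
  by exists gT, G, a, b, c; apply/H3_gensE.
move=> rT H x y z /H3_gensE/ind[-> indH]; split=> //.
by move: indH; rewrite /= !(set_seq1, set_cons) !setUA.
Qed.

Lemma H4_index_two :
  (exists (gT : finGroupType) (G : {group gT}) (a b c : gT), H4_gens G a b c)
   /\ (forall (gT : finGroupType) (G : {group gT}) (a b c : gT),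
       H4_gens G a b c ->
       #|G| = 27 /\
       index_two_witness G
         [set a; a^-1; b; b^-1; a^-1 * b; (a^-1 * b)^-1;
              b * a * b^-1; (b * a * b^-1)^-1]).
Proof.
have [//|[gT [G [gs gensG]]] ind] := presented_index_two H4_certificate.
split.
  case: gs gensG => [|a [|b [|c [|? ?]]]] gensG; try by case: gensG.
  by exists gT, G, a, b, c; apply/H4_gensE.
move=> rT H x y z /H4_gensE/ind[-> indH]; split=> //.
by move: indH; rewrite /= !(set_seq1, set_cons) !setUA.
Qed.

(** * The alternating group of degree four *)

Lemma A4_points :
  [/\ forall i, cycle123 i = nth pt1 [:: pt2; pt3; pt1; pt4] i
    & forall i, swap12_34 i = nth pt1 [:: pt2; pt1; pt4; pt3] i].
Proof.
by split; case=> -[|[|[|[|//]]]] ?; apply: val_inj; rewrite permM !permE.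
Qed.

Lemma A4_satisfies :
  satisfies [:: cycle123; swap12_34] (relators A4_presentation).
Proof.
rewrite satisfies_relators /=; have [xE yE] := A4_points.
apply/and4P; split=> //; apply/eqP/permP=> i; rewrite !expgS expg0 ?mulg1;
  case: i => -[|[|[|[|//]]]] ?; apply: val_inj;
  by rewrite !(permM, xE, yE, perm1).
Qed.

Lemma card_A4 : #|'Alt_('I_4)| = 12.
Proof. by apply: double_inj; rewrite -mul2n card_Alt card_ord. Qed.

(** The order of the generated subgroup is divisible by 3, because of the
3-cycle, and by 4, because the subgroup is transitive on the four points. *)
Lemma A4_generated : <<[set x in [:: cycle123; swap12_34]]>> = 'Alt_('I_4).
Proof.
have [xE yE] := A4_points; rewrite set_cons set_seq1.
set G := <<_>>; have Gx: cycle123 \in G by rewrite mem_gen ?set21.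
have Gy: swap12_34 \in G by rewrite mem_gen ?set22.
apply/eqP; rewrite eqEcard gen_subG subUset !sub1set !Alt_even.
rewrite !odd_permM !odd_tperm card_A4 /= dvdn_leq ?cardG_gt0 //.
rewrite (@Gauss_dvd 3 4) //; apply/andP; split.
  have o3: #[cycle123] = 3.
    apply: nt_prime_order => //.
      by case/and4P: A4_satisfies => /eqP; rewrite /= mulg1.
    by apply/eqP=> /permP/(_ pt1); rewrite xE perm1.
  by rewrite -[X in X %| _]o3 order_dvdG.
suffices o4: #|orbit 'P [group of G] pt1| = 4.
  by rewrite -[X in X %| _]o4 dvdn_orbit.
rewrite -[RHS](card_ord 4) -cardsT; congr #|pred_of_set _|; apply/setP=> i.
rewrite !inE; apply/orbitP.
have act (s : {perm 'I_4}) : 'P%act pt1 s = s pt1 by [].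
case: i => -[|[|[|[|//]]]] ?.
- by exists 1; rewrite ?group1 // act perm1; apply: val_inj.
- by exists cycle123; rewrite // act xE; apply: val_inj.
- exists (cycle123 * cycle123); first exact: groupM.
  by rewrite act (permM cycle123 cycle123) !xE; apply: val_inj.
exists (cycle123 * cycle123 * swap12_34); first exact: groupM (groupM Gx Gx) Gy.
rewrite act (permM _ swap12_34) (permM cycle123 cycle123) !xE yE.
exact: val_inj.
Qed.

Lemma A4_index_two :
  index_two_witness ('Alt_('I_4))%G [set cycle123; cycle123^-1; swap12_34].
Proof.
have large: 12 <= #|'Alt_('I_4)| by rewrite card_A4.
have := certified_index_two A4_certificate A4_satisfies (erefl _)
  A4_generated large.
by rewrite /= !(set_seq1, set_cons) !setUA.
Qed.

(** * Direct products of the quaternion group with a cyclic group *)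

Definition Q8_words := tree_normal_forms 8 Q8_table.

(** In the quaternion group of order 8 any two elements either commute or
satisfy the quaternion relations, and the group is not abelian. *)
Lemma Q8_certificate :
  complete_table 8 Q8_table Q8_words (relators Q8_presentation)
  && all (fun j => all (fun k =>
       (scan Q8_table j (normal_form Q8_words k)
          == scan Q8_table k (normal_form Q8_words j))
       || all (fun r => scan Q8_table 0 (substitute Q8_words [:: j; k] r) == 0)
              (relators Q8_presentation))
     (iota 0 8)) (iota 0 8)
  && (scan Q8_table 0 [:: (false, 0); (false, 1%N)]
        != scan Q8_table 0 [:: (false, 1%N); (false, 0)]).
Proof. by vm_compute. Qed.

(** Generators of a nonabelian group do not commute, so only the second case of
[Q8_certificate] is possible. *)
Lemma quaternion_generators (gT : finGroupType) (i j : gT) :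
    <<[set i; j]>> \isog 'Q_8 ->
  [/\ i ^+ 4 = 1, j ^+ 2 = i ^+ 2 & i ^ j = i^-1].
Proof.
move=> isoQ.
have isoP: Presentation.iso <<[set i; j]>> Q8_presentation.
  exact: isoGrp_trans isoQ (Grp_quaternion (n := 3) isT).
have oQ: #|<<[set i; j]>>| = 8.
  by rewrite (card_isog isoQ) (card_quaternion (n := 3) isT).
have /homGrpE[gs [size_gs gen sat]] := isoGrp_hom isoP.
move: Q8_words Q8_certificate => ws /andP[/andP[tab /allP pairs] noncomm].
have size_gs': size gs = size Q8_table by [].
have large: 8 <= #|<<[set x in gs]>>| by rewrite gen oQ.
have surj x: x \in <<[set i; j]>> -> exists2 k, k < 8 & x = elt ws gs k.
  by rewrite -gen; apply: (elt_surj tab sat size_gs').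
have [ki lti def_i] := surj i (mem_gen (set21 i j)).
have [kj ltj def_j] := surj j (mem_gen (set22 i j)).
have := pairs ki; rewrite mem_iota => /(_ lti)/allP/(_ kj).
rewrite mem_iota => /(_ ltj)/orP[/eqP comm | rels].
  have comm_ij: i * j = j * i.
    by rewrite def_i def_j !(elt_mul tab sat) // comm.
  have cQ: abelian <<[set i; j]>>.
    rewrite abelian_gen; apply/centsP=> x /set2P[]-> y /set2P[]-> //;
      exact: commute_refl.
  case/negP: noncomm; apply/eqP.
  apply: (elt_inj tab sat size_gs' large); rewrite ?(scan_lt tab) //.
  rewrite -!(elt_word tab sat) // /= !mulg1.
  have Qgs k : letter_value gs (false, k) \in <<[set i; j]>>.
    by have := word_value_gen gs [:: (false, k)]; rewrite /= mulg1 gen.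
  exact: (centsP cQ).
suffices: satisfies [:: i; j] (relators Q8_presentation).
  by rewrite satisfies_relators /= => /and4P[/eqP ? /eqP ? /eqP ? _].
apply/allP=> r /(allP rels)/eqP rel_r; rewrite def_i def_j.
rewrite -[[:: _; _]]/[seq elt ws gs k | k <- [:: ki; kj]].
rewrite (word_value_substitute tab).
by rewrite (elt_word tab sat) ?(substitute_wf tab) // rel_r (elt0 tab).
Qed.

Lemma Q8xZ_satisfies (gT : finGroupType) (G : {group gT}) n i j z :
    Q8xZ_gens G n i j z ->
  [/\ satisfies [:: i; j; z] (relators (Q8xZ_presentation n)),
      <<[set x in [:: i; j; z]]>> = G & #|G| = (8 * n)%N].
Proof.
case=> defG isoQ oz; have [i4 j2 ij] := quaternion_generators isoQ.
have [_ defG' cQz _] := dprodP defG.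
have zn: z ^+ n = 1 by rewrite -oz expg_order.
have zi: i * z = z * i.
  by apply/esym; apply: (centsP cQz); rewrite ?cycle_id ?mem_gen ?set21.
have zj: j * z = z * j.
  by apply/esym; apply: (centsP cQz); rewrite ?cycle_id ?mem_gen ?set22.
split.
- by rewrite satisfies_relators /= i4 j2 ij zn zi zj !eqxx.
- rewrite !(set_seq1, set_cons) setUA.
  by rewrite -defG' -(cent_joinEr cQz) joing_idl joing_idr.
rewrite -(dprod_card defG) (card_isog isoQ) (card_quaternion (n := 3) isT).
by rewrite -[#|<[z]>|]/#[z] oz.
Qed.

Lemma Q8xZ_ex m :
  exists (gT : finGroupType) (G : {group gT}) (i j z : gT),
    Q8xZ_gens G m.+1 i j z.
Proof.
have [x [y genQ]] : exists x y : 'Q_8, <<[set x; y]>> = 'Q_8.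
  have /homGrpE[[|x [|y [|? ?]]] [//= _ gen _]] :=
    isoGrp_hom (Grp_quaternion (n := 3) isT).
  by exists x, y; rewrite -[RHS]gen !(set_seq1, set_cons).
pose Zm : finGroupType := 'I_m.+1.
have defQ : <<[set pairg1 Zm x; pairg1 Zm y]>> = setX 'Q_8 1.
  rewrite -[in RHS]genQ -morphim_pairg1 morphim_gen ?subsetT //.
  by rewrite morphimEsub ?subsetT // imsetU !imset_set1.
have defZ : <[pair1g ('Q_8)%type (Zp1 : Zm)]> = setX 1 <[Zp1 : Zm]>.
  by rewrite -morphim_pair1g morphim_cycle ?inE.
exists _, (setX_group [set: 'Q_8] <[Zp1 : Zm]>).
exists (pairg1 Zm x), (pairg1 Zm y), (pair1g ('Q_8)%type (Zp1 : Zm)); split.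
- by rewrite defQ defZ setX_dprod.
- by rewrite defQ -morphim_pairg1 isog_sym sub_isog ?subsetT ?injm_pairg1.
by rewrite order_injm ?injm_pair1g ?inE // order_Zp1.
Qed.

Lemma Q8xZ3_index_two :
  (exists (gT : finGroupType) (G : {group gT}) (i j z : gT),
       Q8xZ_gens G 3 i j z)
   /\ (forall (gT : finGroupType) (G : {group gT}) (i j z : gT),
       Q8xZ_gens G 3 i j z ->
       index_two_witness G
         [set i; i ^+ 2 * i; i * z; (i * z)^-1; j * z; (j * z)^-1]).
Proof.
split=> [|gT G i j z /Q8xZ_satisfies[sat gen oG]]; first exact: Q8xZ_ex.
have large: 24 <= #|G| by rewrite oG.
have := certified_index_two Q8xZ3_certificate sat (erefl _) gen large.
by rewrite /= !(set_seq1, set_cons) !setUA.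
Qed.

Lemma Q8xZ4_index_two :
  (exists (gT : finGroupType) (G : {group gT}) (i j z : gT),
       Q8xZ_gens G 4 i j z)
   /\ (forall (gT : finGroupType) (G : {group gT}) (i j z : gT),
       Q8xZ_gens G 4 i j z ->
       index_two_witness G
         [set z; z^-1; i; i ^+ 2 * i; j; i ^+ 2 * j; i * z; (i * z)^-1;
              i ^+ 2 * (i * j) * z; (i ^+ 2 * (i * j) * z)^-1]).
Proof.
split=> [|gT G i j z /Q8xZ_satisfies[sat gen oG]]; first exact: Q8xZ_ex.
have large: 32 <= #|G| by rewrite oG.
have := certified_index_two Q8xZ4_certificate sat (erefl _) gen large.
by rewrite /= !(set_seq1, set_cons) !setUA.
Qed.

(** * The theorem *)

Theorem mainTheorem4 :
  (forall n : nat, n \in [:: 3; 4; 5] ->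
    (exists (gT : finGroupType) (G : {group gT}) (a b : gT),
       dihedral_gens G n a b)
    /\ (forall (gT : finGroupType) (G : {group gT}) (a b : gT),
       dihedral_gens G n a b ->
       #|G| = (2 * n)%N /\ index_two_witness G [set a; a * b]))
  /\
  index_two_witness ('Alt_('I_4))%G [set cycle123; cycle123^-1; swap12_34]
  /\
  ((exists (gT : finGroupType) (G : {group gT}) (a b c : gT), H1_gens G a b c)
   /\ (forall (gT : finGroupType) (G : {group gT}) (a b c : gT),
       H1_gens G a b c ->
       #|G| = 16 /\
       index_two_witness G [set a; b; c; a * b; (a * b)^-1]))
  /\
  ((exists (gT : finGroupType) (G : {group gT}) (a b : gT), H2_gens G a b)
   /\ (forall (gT : finGroupType) (G : {group gT}) (a b : gT),
       H2_gens G a b ->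
       #|G| = 16 /\
       index_two_witness G [set a; a^-1; a ^+ 2; a ^- 2; b]))
  /\
  ((exists (gT : finGroupType) (G : {group gT}) (a b c : gT), H3_gens G a b c)
   /\ (forall (gT : finGroupType) (G : {group gT}) (a b c : gT),
       H3_gens G a b c ->
       #|G| = 18 /\
       index_two_witness G [set a; a^-1; c; a * c; b * c]))
  /\
  ((exists (gT : finGroupType) (G : {group gT}) (a b c : gT), H4_gens G a b c)
   /\ (forall (gT : finGroupType) (G : {group gT}) (a b c : gT),
       H4_gens G a b c ->
       #|G| = 27 /\
       index_two_witness G
         [set a; a^-1; b; b^-1; a^-1 * b; (a^-1 * b)^-1;
              b * a * b^-1; (b * a * b^-1)^-1]))
  /\
  ((exists (gT : finGroupType) (G : {group gT}) (i j z : gT),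
       Q8xZ_gens G 3 i j z)
   /\ (forall (gT : finGroupType) (G : {group gT}) (i j z : gT),
       Q8xZ_gens G 3 i j z ->
       index_two_witness G
         [set i; i ^+ 2 * i; i * z; (i * z)^-1; j * z; (j * z)^-1]))
  /\
  ((exists (gT : finGroupType) (G : {group gT}) (i j z : gT),
       Q8xZ_gens G 4 i j z)
   /\ (forall (gT : finGroupType) (G : {group gT}) (i j z : gT),
       Q8xZ_gens G 4 i j z ->
       index_two_witness G
         [set z; z^-1; i; i ^+ 2 * i; j; i ^+ 2 * j; i * z; (i * z)^-1;
              i ^+ 2 * (i * j) * z; (i ^+ 2 * (i * j) * z)^-1])).
Proof.
split; first exact: dihedral_index_two.
split; first exact: A4_index_two.
split; first exact: H1_index_two.
split; first exact: H2_index_two.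
split; first exact: H3_index_two.
split; first exact: H4_index_two.
split; [exact: Q8xZ3_index_two | exact: Q8xZ4_index_two].
Qed.
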